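(* Let $\sigma\subset N_{\mathbb{R}}$ be a full-dimensional strongly convex rational polyhedral cone such that $\sigma^\vee$ is $G$-stable. For $p=0$ or $p$ prime let $\Sigma_p$ be the normal fan of $\mathcal{N}_p(\sigma)$ and let $X(\Sigma_p)$ be the associated toric variety over an algebraically closed field of characteristic $p$. Let $\mathcal{P}$ be any property of $X(\Sigma_p)$ that corresponds to a combinatorial property of $\Sigma_p$, i.e. there is a property $\mathcal{Q}$ of fans such that, for every $p$ (zero or prime), $X(\Sigma_p)$ has $\mathcal{P}$ if and only if $\Sigma_p$ has $\mathcal{Q}$. Then $\mathcal{P}$ holds for $X(\Sigma_0)$ if and only if $\mathcal{P}$ holds for $X(\Sigma_p)$, for all primes $p>0$. In particular, $X(\Sigma_0)$ is non-singular if and only if $X(\Sigma_p)$ is non-singular.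
   Context: $M$ and $N$ are dual free abelian groups of finite rank $d$, $M_{\mathbb{R}}=M\otimes_{\mathbb{Z}}\mathbb{R}$, $N_{\mathbb{R}}=N\otimes_{\mathbb{Z}}\mathbb{R}$. ''Cone'' means strictly (strongly) convex rational polyhedral cone; it is full-dimensional if its dimension equals the rank of the lattice. $\sigma^\vee\subset M_{\mathbb{R}}$ is the dual cone of $\sigma$. $X(\Sigma)$ is the normal toric variety of a fan $\Sigma$ in $N_{\mathbb{R}}$. For a cone $\tau\subset M_{\mathbb{R}}$: $G(\tau)$ is the minimal generating set (Hilbert basis) of the semigroup $\tau\cap M$; $\Gamma_+(\tau)=\operatorname{Conv}((\tau\cap M)\setminus\{0\})$; $\Gamma(\tau)$ is the union of the compact faces of $\Gamma_+(\tau)$. For $A\subset M$, $\sigma_A=\operatorname{Cone}(A)$. The cone $\tau$ is $G$-stable if (i) $G(\tau)=\Gamma(\tau)\cap M$, and (ii) $G(\sigma_A)=G(\tau)\cap\sigma_A$ for every $A\subset G(\tau)$. Fix a $\mathbb{Z}$-basis of $M$. Let $\det_0(h_1\cdots h_d)$ be the determinant of the matrix with columns $h_1,\dots,h_d\in M$, and for $p$ prime let $\det_p$ be this determinant modulo $p$. For $p=0$ or $p$ prime, $$\mathcal{N}_p(\sigma)=\operatorname{Conv}\big\{(h_1+\dots+h_d)+\sigma^\vee\mid h_i\in G(\sigma^\vee)\text{ and }\det_p(h_1\cdots h_d)\neq0\big\}$$ (convex hull of the union of these translates of $\sigma^\vee$). The normal fan of a full-dimensional lattice polyhedron $Q\subset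 M_{\mathbb{R}}$ is the fan in $N_{\mathbb{R}}$ whose maximal cones are the $\sigma_v$, for $v$ a vertex of $Q$, where $\sigma_v$ is the dual of the cone generated by $\{w-v\mid w\in Q\}$. (The normalized Nash blowup of the affine toric variety $X(\sigma)$ over an algebraically closed field of characteristic $p$ is $X(\Sigma_p)\to X(\sigma)$.) *)

(* Defs.v *)
From HB Require Import structures.
From mathcomp Require Import all_boot all_order all_algebra.
From mathcomp Require Import all_classical all_reals all_analysis.

Set Implicit Arguments.
Unset Strict Implicit.
Unset Printing Implicit Defensive.

Import Order.TTheory GRing.Theory Num.Theory.
Import numFieldNormedType.Exports.

Local Open Scope classical_set_scope.
Local Open Scope ring_scope.

(* After the choice of a Z-basis of M (and of the dual basis of N), both M and
   N are Z^d, both M_R and N_R are R^d, and the duality is the dot product. *)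

Section Cones.
Context {R : realType} {d : nat}.
Implicit Types (u v w : 'rV[R]_d) (m : 'rV[int]_d).

Definition pairing u v : R := (u *m v^T) 0 0.

Definition toR m : 'rV[R]_d := map_mx intr m.

Definition lattice_pts (X : set 'rV[R]_d) : set 'rV[int]_d := toR @^-1` X.

Definition cone_hull (A : set 'rV[R]_d) : set 'rV[R]_d :=
  [set v | exists n (a : 'I_n -> 'rV[R]_d) (c : 'I_n -> R),
     [/\ forall i, A (a i), forall i, 0 <= c i & v = \sum_i c i *: a i]].

Definition conv_hull (A : set 'rV[R]_d) : set 'rV[R]_d :=
  smallest (@convex_set R 'rV[R]_d) A.

Definition dual_cone (C : set 'rV[R]_d) : set 'rV[R]_d :=
  [set u | forall v, C v -> 0 <= pairing u v].

Definition rational_polyhedral_cone (C : set 'rV[R]_d) : Prop :=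
  exists s : seq 'rV[int]_d, C = cone_hull (toR @` [set` s]).

Definition strongly_convex (C : set 'rV[R]_d) : Prop :=
  forall v, C v -> C (- v) -> v = 0.

(* C contains d linearly independent vectors, the rows of B *)
Definition full_dimensional (C : set 'rV[R]_d) : Prop :=
  exists B : 'M[R]_d, (forall i, C (row i B)) /\ row_free B.

Definition cone_face (C F : set 'rV[R]_d) : Prop :=
  exists2 u, dual_cone C u & F = C `&` [set v | pairing u v = 0].

(* P itself is the face cut out by u = 0, b = 0 *)
Definition face (P F : set 'rV[R]_d) : Prop :=
  exists u (b : R), (forall v, P v -> b <= pairing u v) /\
    F = P `&` [set v | pairing u v = b].

Definition vertex (P : set 'rV[R]_d) v : Prop := face P [set v].

Definition generates_semigroup (C : set 'rV[R]_d) (A : set 'rV[int]_d) : Prop :=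
  A `<=` lattice_pts C /\
  forall m, lattice_pts C m ->
    exists2 s : seq 'rV[int]_d, [set` s] `<=` A & m = \sum_(a <- s) a.

(* The intersection of all generating sets; for a strongly convex rational
   polyhedral cone it is itself a generating set, hence the smallest one. *)
Definition hilbert_basis (C : set 'rV[R]_d) : set 'rV[int]_d :=
  \bigcap_(A in generates_semigroup C) A.

Definition Gamma_plus (C : set 'rV[R]_d) : set 'rV[R]_d :=
  conv_hull (toR @` (lattice_pts C `\ 0)).

Definition Gamma (C : set 'rV[R]_d) : set 'rV[R]_d :=
  \bigcup_(F in [set F | face (Gamma_plus C) F /\ compact F]) F.

Definition cone_of (A : set 'rV[int]_d) : set 'rV[R]_d := cone_hull (toR @` A).

Definition G_stable (C : set 'rV[R]_d) : Prop :=
  hilbert_basis C = lattice_pts (Gamma C) /\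
  forall A : set 'rV[int]_d, A `<=` hilbert_basis C ->
    hilbert_basis (cone_of A) = hilbert_basis C `&` lattice_pts (cone_of A).

(* determinant of the matrix with columns h_1, ..., h_d, reduced modulo p;
   modz z 0 = z, so that p = 0 gives the determinant itself *)
Definition detp (p : nat) (h : 'I_d -> 'rV[int]_d) : int :=
  modz (\det (\matrix_(i < d, j < d) h j 0 i)) p.

Definition nash_polyhedron (p : nat) (sigma : set 'rV[R]_d) : set 'rV[R]_d :=
  conv_hull [set v | exists h : 'I_d -> 'rV[int]_d,
    [/\ forall i, hilbert_basis (dual_cone sigma) (h i),
        detp p h != 0
      & exists2 w, dual_cone sigma w & v = toR (\sum_i h i) + w]].

Definition vertex_cone (Q : set 'rV[R]_d) v : set 'rV[R]_d :=
  dual_cone (cone_hull [set w - v | w in Q]).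

(* a fan is the set of its cones *)
Definition normal_fan (Q : set 'rV[R]_d) : set (set 'rV[R]_d) :=
  [set g | exists2 v, vertex Q v & cone_face (vertex_cone Q v) g].

Definition nash_fan (p : nat) (sigma : set 'rV[R]_d) : set (set 'rV[R]_d) :=
  normal_fan (nash_polyhedron p sigma).

End Cones.

(* [regular U f] says that f is a regular function on the open set U; only
   the values of f on U matter. *)
Record function_space (k : fieldType) := FunctionSpace {
  point :> Type;
  is_open : set point -> Prop;
  regular : set point -> (point -> k) -> Prop }.

Section Nonsingular.
Context {k : fieldType} (X : function_space k).
Implicit Types (x : X) (f g : X -> k) (Z : set X).

Definition near_eq x f g : Prop :=
  exists U : set X, [/\ is_open U, U x & forall y, U y -> f y = g y].

(* germs are represented by functions that are regular near x, considered up
   to [near_eq x] *)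
Definition max_ideal x f : Prop :=
  (exists U : set X, [/\ is_open U, U x & regular U f]) /\ f x = 0.

Definition max_ideal_sq x f : Prop :=
  exists n (a b : 'I_n -> X -> k),
    [/\ forall i, max_ideal x (a i), forall i, max_ideal x (b i)
      & near_eq x f (fun y => \sum_i a i y * b i y)].

(* t_1, ..., t_n induce a k-basis of m_x / m_x^2 *)
Definition cotangent_dim x (n : nat) : Prop :=
  exists t : 'I_n -> X -> k, (forall i, max_ideal x (t i)) /\
    forall f, max_ideal x f ->
      exists! c : 'rV[k]_n, max_ideal_sq x (fun y => f y - \sum_i c 0 i * t i y).

Definition is_closed Z : Prop := is_open (~` Z).

Definition irreducible_closed Z : Prop :=
  [/\ is_closed Z, Z !=set0
    & forall Z1 Z2, is_closed Z1 -> is_closed Z2 ->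
        Z `<=` Z1 `|` Z2 -> Z `<=` Z1 \/ Z `<=` Z2].

Definition chain_at x (n : nat) : Prop :=
  exists Z : nat -> set X,
    [/\ Z 0%N x, forall i, (i <= n)%N -> irreducible_closed (Z i)
      & forall i, (i < n)%N -> Z i `<` Z i.+1].

(* The Krull dimension of the local ring O_x: prime ideals of O_x correspond
   to the irreducible closed subsets through x. *)
Definition local_dim x (n : nat) : Prop :=
  chain_at x n /\ forall m, chain_at x m -> (m <= n)%N.

(* every O_x is a regular local ring *)
Definition nonsingular : Prop :=
  forall x, exists2 n, local_dim x n & cotangent_dim x n.

End Nonsingular.

Section ToricVariety.
Context {R : realType} {d : nat} (k : fieldType).
Implicit Types (g : set 'rV[R]_d) (x y : 'rV[int]_d -> k).

Definition dual_semigroup g : set 'rV[int]_d := lattice_pts (dual_cone g).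

(* A closed point of U_g = Spec k[S_g] is a k-algebra morphism k[S_g] -> k,
   i.e. a monoid morphism S_g -> (k, * ), extended here by 0 outside S_g. *)
Definition chart g : set ('rV[int]_d -> k) :=
  [set x | [/\ x 0 = 1,
     forall a b, dual_semigroup g a -> dual_semigroup g b ->
       x (a + b) = x a * x b
   & forall a, ~ dual_semigroup g a -> x a = 0]].

(* the elements of k[S_g], as functions on U_g *)
Definition chart_poly g (f : ('rV[int]_d -> k) -> k) : Prop :=
  exists n (a : 'I_n -> 'rV[int]_d) (c : 'I_n -> k),
    (forall i, dual_semigroup g (a i)) /\ f = (fun x => \sum_i c i * x (a i)).

Definition chart_open g (V : set ('rV[int]_d -> k)) : Prop :=
  V `<=` chart g /\
  forall x, V x -> exists f,
    [/\ chart_poly g f, f x != 0 & forall y, chart g y -> f y != 0 -> V y].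

Definition chart_regular g (V : set ('rV[int]_d -> k))
    (phi : ('rV[int]_d -> k) -> k) : Prop :=
  forall x, V x -> exists f h,
    [/\ chart_poly g f, chart_poly g h, h x != 0
      & forall y, V y -> h y != 0 -> phi y = f y / h y].

Context (Sigma : set (set 'rV[R]_d)).

Definition chart_point := (set 'rV[R]_d * ('rV[int]_d -> k))%type.

Definition in_atlas (q : chart_point) : Prop := Sigma q.1 /\ chart q.1 q.2.

(* U_g and U_g' are glued along U_(g `&` g'), whose inclusions into U_g and
   U_g' restrict morphisms from S_(g `&` g') to S_g and S_g'. *)
Definition glued (q q' : chart_point) : Prop :=
  [/\ in_atlas q, in_atlas q'
    & exists y, [/\ chart (q.1 `&` q'.1) y,
        forall a, dual_semigroup q.1 a -> q.2 a = y a
      & forall a, dual_semigroup q'.1 a -> q'.2 a = y a]].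

Definition toric_point :=
  {c : set chart_point | exists2 q, in_atlas q & c = glued q}.

(* [chart_coord g x P]: the point x of U_g is mapped to P *)
Definition chart_coord g x (P : toric_point) : Prop := sval P (g, x).

Definition chart_preimage g (U : set toric_point) : set ('rV[int]_d -> k) :=
  [set x | exists2 P, U P & chart_coord g x P].

Definition toric_open (U : set toric_point) : Prop :=
  forall g, Sigma g -> chart_open g (chart_preimage g U).

Definition toric_regular (U : set toric_point) (phi : toric_point -> k) : Prop :=
  toric_open U /\
  forall g, Sigma g -> exists2 psi, chart_regular g (chart_preimage g U) psi
    & forall x P, U P -> chart_coord g x P -> phi P = psi x.

Definition toric_variety : function_space k :=
  FunctionSpace toric_open toric_regular.

End ToricVariety.

Definition has_characteristic (k : fieldType) (p : nat) : Prop :=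
  if p == 0%N then [pchar k] =i pred0 else p \in [pchar k].

(* Main.v *)
(* The normal fan of N_p does not depend on p because N_p itself does not.  If
   h_1, ..., h_d in G generate a cone that is not unimodular, its Hilbert basis
   contains some g distinct from the h_i; G-stability gives g in G, and g lies
   on a compact face, so that g = sum_i c_i h_i with C = sum_i c_i <= 1.  Then
     sum_i h_i = sum_j (c_j / C) (sum_i h_i - h_j + g) + (1 / C - 1) g,
   and the exchanged bases have smaller determinants c_j det(h).  By induction
   N_p is generated by the bases of determinant 1 or -1, whatever p is.

   Nonsingularity is combinatorial over every algebraically closed field: X is
   nonsingular if and only if the dual semigroup of every maximal cone is free.
   The local dimension is at most d, because d + 1 elements of k[S] are
   algebraically dependent: there are more monomials of bounded degree in them
   than characters.  At the fixed point of a chart the irreducible elements of S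
   are independent in the cotangent space, so nonsingularity leaves at most d of
   them; as they generate Z^d, they form a basis. *)

Require Import Defs.
From HB Require Import structures.
From mathcomp Require Import all_boot all_order all_algebra.
From mathcomp Require Import all_classical all_reals all_analysis.
From mathcomp Require Import zify ring lra.

Set Implicit Arguments.
Unset Strict Implicit.
Unset Printing Implicit Defensive.

Import Order.TTheory GRing.Theory Num.Theory.
Import numFieldNormedType.Exports.

Local Open Scope classical_set_scope.
Local Open Scope ring_scope.

(** * Rational polyhedral cones *)

Section Pairing.
Context {R : realType} {d : nat}.
Implicit Types (u v w : 'rV[R]_d) (m : 'rV[int]_d).

(** Equal fans do not identify the two varieties, which live over different fields; nonsingularity
    has to be restated through the vertex cones alone, without mention of the field. As
    [nonsingular] speaks of germs on a glued space, statements about germs are turned into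
    statements about Laurent polynomials on a chart, by multiplying with functions that do not
    vanish at the point. A relation between polynomial functions on a chart is formal, by
    independence of characters, and can therefore be evaluated at a tangent vector, which is not a
    point of the chart. For the converse, a chart with free semigroup is an affine space:
    first-order expansions and partial derivatives give the cotangent space, and closures of
    coordinate subspaces give a chain of length [d]. The charts of smaller cones need no separate
    study, since every cone of the fan lies in a vertex cone. Transitivity of gluing and regularity
    of fractions rest on characters that separate two cones of the fan. *)

Lemma pairingE u v : pairing u v = \sum_j u 0 j * v 0 j.
Proof. by rewrite /pairing mxE; apply: eq_bigr => j _; rewrite mxE. Qed.

Lemma pairingC u v : pairing u v = pairing v u.
Proof. by rewrite !pairingE; apply: eq_bigr => j _; rewrite mulrC. Qed.

Lemma pairingDl u v w : pairing (u + v) w = pairing u w + pairing v w.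
Proof. by rewrite /pairing mulmxDl mxE. Qed.

Lemma pairingZl c u w : pairing (c *: u) w = c * pairing u w.
Proof. by rewrite /pairing -scalemxAl mxE. Qed.

Lemma pairingNl u w : pairing (- u) w = - pairing u w.
Proof. by rewrite -scaleN1r pairingZl mulN1r. Qed.

Lemma pairing0l w : pairing 0 w = 0.
Proof. by rewrite -(scale0r w) pairingZl mul0r. Qed.

Lemma pairingDr u v w : pairing u (v + w) = pairing u v + pairing u w.
Proof. by rewrite pairingC pairingDl !(pairingC u). Qed.

Lemma pairingZr c u w : pairing u (c *: w) = c * pairing u w.
Proof. by rewrite pairingC pairingZl (pairingC u). Qed.

Lemma pairingNr u w : pairing u (- w) = - pairing u w.
Proof. by rewrite pairingC pairingNl (pairingC u). Qed.

Lemma pairingBr u v w : pairing u (v - w) = pairing u v - pairing u w.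
Proof. by rewrite pairingDr pairingNr. Qed.

Lemma pairing0r u : pairing u 0 = 0.
Proof. by rewrite pairingC pairing0l. Qed.

Lemma pairing_suml I (r : seq I) (P : pred I) (F : I -> 'rV[R]_d) w :
  pairing (\sum_(i <- r | P i) F i) w = \sum_(i <- r | P i) pairing (F i) w.
Proof.
by elim/big_rec2: _ => [|i x y _ <-]; rewrite ?pairing0l ?pairingDl.
Qed.

Lemma pairing_sumr I (r : seq I) (P : pred I) (F : I -> 'rV[R]_d) w :
  pairing w (\sum_(i <- r | P i) F i) = \sum_(i <- r | P i) pairing w (F i).
Proof. by rewrite pairingC pairing_suml; under eq_bigr do rewrite pairingC. Qed.

Lemma toRD m n : toR (m + n) = toR m + toR n :> 'rV[R]_d.
Proof. exact: map_mxD. Qed.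

Lemma toRN m : toR (- m) = - toR m :> 'rV[R]_d.
Proof. exact: map_mxN. Qed.

Lemma toRB m n : toR (m - n) = toR m - toR n :> 'rV[R]_d.
Proof. exact: map_mxB. Qed.

Lemma toR0 : toR 0 = 0 :> 'rV[R]_d.
Proof. exact: map_mx0. Qed.

Lemma toR_sum I (r : seq I) (P : pred I) (F : I -> 'rV[int]_d) :
  toR (\sum_(i <- r | P i) F i) = \sum_(i <- r | P i) toR (F i) :> 'rV[R]_d.
Proof. by elim/big_rec2: _ => [|i x y _ <-]; rewrite ?toR0 ?toRD. Qed.

Lemma toRMn m n : toR (m *+ n) = n%:R *: toR m :> 'rV[R]_d.
Proof.
by elim: n => [|n IH]; rewrite ?scale0r ?toR0 // mulrS toRD IH -natr1 addrC scalerDl scale1r.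
Qed.

Lemma toRZ c m : toR (c *: m) = c%:~R *: toR m :> 'rV[R]_d.
Proof. exact: map_mxZ. Qed.

Lemma toR_inj : injective (@toR R d).
Proof.
move=> m n /rowP E; apply/rowP => j.
by move: (E j); rewrite !mxE => /intr_inj.
Qed.

Definition ipair (m n : 'rV[int]_d) : int := (m *m n^T) 0 0.

Lemma pairing_toR m n : pairing (toR m) (toR n) = (ipair m n)%:~R :> R.
Proof.
rewrite pairingE /ipair mxE rmorph_sum; apply: eq_bigr => j _.
by rewrite !mxE rmorphM.
Qed.

End Pairing.

Section Cone.
Context {R : realType} {d : nat}.
Implicit Types (u v w : 'rV[R]_d) (m : 'rV[int]_d) (A C : set 'rV[R]_d).

Lemma cone_hull0 A : cone_hull A 0.
Proof.
exists 0%N, (fun=> 0), (fun=> 0); split=> //; [by case | by rewrite big_ord0].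
Qed.

Lemma cone_hullD A u v : cone_hull A u -> cone_hull A v -> cone_hull A (u + v).
Proof.
move=> [n [a [c [Aa c0 ->]]]] [n' [a' [c' [Aa' c0' ->]]]].
exists (n + n')%N,
  (fun i : 'I_(n + n') => match fintype.split i with inl j => a j | inr j => a' j end),
  (fun i : 'I_(n + n') => match fintype.split i with inl j => c j | inr j => c' j end); split.
- by move=> i; case: (fintype.split i).
- by move=> i; case: (fintype.split i).
rewrite big_split_ord /=; congr (_ + _); apply: eq_bigr => i _.
- by rewrite -[lshift _ i]/(unsplit (inl i)) unsplitK.
- by rewrite -[rshift _ i]/(unsplit (inr i)) unsplitK.
Qed.

Lemma cone_hullZ A k u : 0 <= k -> cone_hull A u -> cone_hull A (k *: u).
Proof.
move=> k0 [n [a [c [Aa c0 ->]]]]; exists n, a, (fun i => k * c i); split=> //.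
  by move=> i; rewrite mulr_ge0.
by rewrite scaler_sumr; apply: eq_bigr => i _; rewrite scalerA.
Qed.

Lemma sub_cone_hull A : A `<=` cone_hull A.
Proof.
move=> u Au; exists 1%N, (fun=> u), (fun=> 1); split=> //.
by rewrite big_ord1 scale1r.
Qed.

Lemma cone_hull_sum A I (r : seq I) (P : pred I) (F : I -> 'rV[R]_d) :
  (forall i, P i -> cone_hull A (F i)) -> cone_hull A (\sum_(i <- r | P i) F i).
Proof. by move=> AF; apply: big_ind => //; [exact: cone_hull0 | exact: cone_hullD]. Qed.

Lemma cone_hull_min A C :
  C 0 -> (forall u v, C u -> C v -> C (u + v)) ->
  (forall k u, 0 <= k -> A u -> C (k *: u)) -> cone_hull A `<=` C.
Proof.
move=> C0 CD CZ _ [n [a [c [Aa c0 ->]]]].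
by apply: big_ind => // i _; apply: CZ.
Qed.

Lemma cone_hullS A A' : A `<=` cone_hull A' -> cone_hull A `<=` cone_hull A'.
Proof.
move=> AA'; apply: cone_hull_min; [exact: cone_hull0 | exact: cone_hullD |].
by move=> k u k0 /AA'; exact: cone_hullZ.
Qed.

Lemma dual_cone0 C : dual_cone C 0.
Proof. by move=> v _; rewrite pairing0l. Qed.

Lemma dual_coneD C u v : dual_cone C u -> dual_cone C v -> dual_cone C (u + v).
Proof. by move=> Cu Cv w Cw; rewrite pairingDl addr_ge0 ?Cu ?Cv. Qed.

Lemma dual_coneZ C k u : 0 <= k -> dual_cone C u -> dual_cone C (k *: u).
Proof. by move=> k0 Cu w Cw; rewrite pairingZl mulr_ge0 ?Cu. Qed.

Lemma dual_cone_hull A u :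
  dual_cone (cone_hull A) u <-> forall a, A a -> 0 <= pairing u a.
Proof.
split=> [Du a Aa|Du]; first by apply: Du; exact: sub_cone_hull.
apply: cone_hull_min; first by rewrite pairing0r.
- by move=> v w v0 w0; rewrite pairingDr addr_ge0.
- by move=> k v k0 Av; rewrite pairingZr mulr_ge0 ?Du.
Qed.

Lemma sub_bidual A : A `<=` dual_cone (dual_cone A).
Proof. by move=> a Aa u Du; rewrite pairingC; apply: Du. Qed.

Definition icone (E : seq 'rV[int]_d) : set 'rV[R]_d := cone_hull (toR @` [set` E]).

Lemma icone_gen E e : e \in E -> icone E (toR e).
Proof. by move=> Ee; apply: sub_cone_hull; exists e. Qed.

(** The coefficient [t] of one generator is singled out, as the variable to be eliminated. *)
Lemma icone_cons e E v :
  icone (e :: E) v <-> exists2 t, 0 <= t & icone E (v - t *: toR e).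
Proof.
split.
  move: v; apply: cone_hull_min.
  - by exists 0 => //; rewrite scale0r subr0; exact: cone_hull0.
  - move=> u v [t t0 Et] [s s0 Es]; exists (t + s); first exact: addr_ge0.
    by rewrite scalerDl opprD addrACA; exact: cone_hullD.
  - move=> k u k0 [f + <-]; rewrite /= inE => /orP[/eqP->|fE].
      by exists k => //; rewrite subrr; exact: cone_hull0.
    exists 0 => //; rewrite scale0r subr0; apply: cone_hullZ => //.
    exact: icone_gen.
move=> [t t0 Et]; rewrite -(subrK (t *: toR e) v); apply: cone_hullD.
  apply: cone_hullS Et => _ [f fE <-]; apply: icone_gen.
  by rewrite inE [f \in E]fE orbT.
by apply: cone_hullZ => //; apply: icone_gen; rewrite mem_head.
Qed.

(** A generator may occur several times in a combination; collecting its terms at its first index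
    leaves one coefficient per position of [E]. *)
Lemma icone_coef E v : icone E v ->
  exists2 c : 'I_(size E) -> R, forall i, 0 <= c i
    & v = \sum_i c i *: toR (nth 0 E i).
Proof.
move: v; apply: cone_hull_min.
- exists (fun=> 0) => //; rewrite big1 // => i _; exact: scale0r.
- move=> u v [c c0 ->] [c' c'0 ->]; exists (fun i => c i + c' i).
    by move=> i; exact: addr_ge0.
  by rewrite -big_split; apply: eq_bigr => i _; rewrite scalerDl.
- move=> k u k0 [f fE <-].
  have fE' : (index f E < size E)%N by rewrite index_mem.
  exists (fun i => if i == Ordinal fE' then k else 0).
    by move=> i; case: ifP.
  rewrite (bigD1 (Ordinal fE')) //= eqxx nth_index // big1 ?addr0 //.
  by move=> i /negbTE->; rewrite scale0r.
Qed.

Lemma icone_nil v : icone [::] v <-> v = 0.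
Proof.
split=> [/icone_coef[c _ ->]|->]; last exact: cone_hull0.
by rewrite big1 // => -[].
Qed.

(* Fourier-Motzkin elimination of the coefficient of one generator. *)
Lemma icone_halfspaces (E : seq 'rV[int]_d) : exists F : seq 'rV[int]_d,
  forall v, icone E v <-> forall f, f \in F -> 0 <= pairing v (toR f).
Proof.
elim: E => [|e E [F IH]].
  exists ([seq delta_mx 0 i | i : 'I_d] ++ [seq - delta_mx 0 i | i : 'I_d]) => v.
  have dE i : pairing v (toR (delta_mx 0 i)) = v 0 i.
    rewrite pairingE (bigD1 i) //= !mxE !eqxx mulr1 big1 ?addr0 // => j ji.
    by rewrite !mxE (negbTE ji) andbF mulr0.
  rewrite icone_nil; split=> [-> f _|vF]; first by rewrite pairing0l.
  apply/rowP => i; rewrite mxE; apply/le_anti/andP; split.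
    rewrite -oppr_ge0 -dE -pairingNr -toRN; apply: vF.
    by rewrite mem_cat; apply/orP; right; apply/mapP; exists i; rewrite ?mem_enum.
  rewrite -dE; apply: vF.
  by rewrite mem_cat; apply/orP; left; apply/mapP; exists i; rewrite ?mem_enum.
exists ([seq f <- F | 0 <= ipair e f] ++
  [seq ipair e f *: g - ipair e g *: f
     | f <- [seq f <- F | 0 < ipair e f], g <- [seq g <- F | ipair e g < 0]]) => v.
rewrite icone_cons; split.
  move=> [t t0 /IH vF].
  have {}vF f : f \in F -> t * (ipair e f)%:~R <= pairing v (toR f).
    move=> /vF; rewrite pairingC pairingBr pairingZr !(pairingC _ (toR f)) subr_ge0.
    by rewrite (pairingC (toR f) (toR e)) pairing_toR.
  move=> f; rewrite mem_cat => /orP[|].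
    rewrite mem_filter => /andP[f0 fF]; apply: le_trans (vF f fF).
    by rewrite mulr_ge0 // ler0z.
  move=> /allpairsP[[f1 g1] /= [+ + ->]].
  rewrite !mem_filter => /andP[f0 fF] /andP[g0 gF].
  rewrite toRB !toRZ pairingBr !pairingZr.
  have h1 : (0:R) < (ipair e f1)%:~R by rewrite ltr0z.
  have h2 : (ipair e g1)%:~R < (0:R) by rewrite ltrz0.
  have := vF _ fF; have := vF _ gF; nra.
move=> vF.
(* The forms negative on [e] bound [t] from below, those positive on [e] bound it from above. [t] is
   the largest lower bound, and the combined forms say that no lower bound exceeds an upper one. The
   default 0 is the constraint [0 <= t]. *)
pose t := \big[Num.max/0]_(g <- F | ipair e g < 0)
            (pairing v (toR g) / (ipair e g)%:~R).
have t0 : 0 <= t.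
  by rewrite /t; elim/big_rec: _ => // g x _ x0; rewrite le_max x0 orbT.
exists t => //; apply/IH => f fF.
rewrite pairingC pairingBr pairingZr !(pairingC (toR f)) pairing_toR subr_ge0.
have [fneg|fpos|f0] := ltgtP (ipair e f) 0; first last.
- rewrite f0 mulr0; apply: vF; rewrite mem_cat mem_filter f0 lexx fF //.
- have h1 : (0:R) < (ipair e f)%:~R by rewrite ltr0z.
  rewrite -ler_pdivlMr // /t big_seq_cond; elim/big_ind: _.
  + apply: divr_ge0; last exact: ltW.
    apply: vF; by rewrite mem_cat mem_filter fF ltW.
  + by move=> x y xf yf; rewrite ge_max xf.
  + move=> g /andP[gF gneg].
    have h2 : (ipair e g)%:~R < (0:R) by rewrite ltrz0.
    have := vF (ipair e f *: g - ipair e g *: f).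
    have -> : ipair e f *: g - ipair e g *: f \in [seq f0 <- F | 0 <= ipair e f0] ++
       [seq ipair e f0 *: g0 - ipair e g0 *: f0
          | f0 <- [seq f0 <- F | 0 < ipair e f0],
            g0 <- [seq g0 <- F | ipair e g0 < 0]].
      rewrite mem_cat; apply/orP; right; apply/allpairsP; exists (f, g).
      by rewrite !mem_filter fpos gneg fF gF.
    move=> /(_ isT); rewrite toRB !toRZ pairingBr !pairingZr => h.
    rewrite ler_ndivrMr // mulrAC ler_pdivrMr //; nra.
- have h2 : (ipair e f)%:~R < (0:R) by rewrite ltrz0.
  rewrite -ler_ndivrMr // /t.
  by rewrite -/t; move: fF fneg; exact: le_bigmax_seq.
Qed.

(** The half-space description replaces a separation theorem: each of its normals belongs to the
    dual cone. *)
Lemma icone_bidual E : dual_cone (dual_cone (icone E)) = icone E.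
Proof.
apply/seteqP; split; last exact: sub_bidual.
have [F EF] := icone_halfspaces E.
move=> v vE; apply/EF => f fF; apply: vE => w /EF /(_ _ fF).
by rewrite pairingC.
Qed.

(** The normals of the half-spaces generate the dual cone: the dual of their cone is [icone E], and
    their cone equals its own bidual. *)
Lemma dual_icone E : exists F, dual_cone (icone E) = icone F.
Proof.
have [F EF] := icone_halfspaces E; exists F; rewrite -(icone_bidual F).
congr dual_cone; apply/seteqP; split=> v.
  by move=> /EF vF; apply/dual_cone_hull => _ [f fF <-]; exact: vF.
by move=> vF; apply/EF => f fF; apply: vF; exact: icone_gen.
Qed.

End Cone.

(** * Irreducible lattice points and Hilbert bases *)

Section Irreducible.
Context {R : realType} {d : nat}.
Implicit Types (u v w : 'rV[R]_d) (a b m : 'rV[int]_d) (C : set 'rV[R]_d).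
Implicit Types (E : seq 'rV[int]_d).

Definition irreducible_in C a : Prop :=
  [/\ lattice_pts C a, a <> 0 & forall b c, lattice_pts C b -> lattice_pts C c ->
        a = b + c -> b = 0 \/ c = 0].

Lemma icone0 E : lattice_pts (@icone R d E) 0.
Proof. by rewrite /lattice_pts /= toR0; exact: cone_hull0. Qed.

Lemma icone_latD E a b : lattice_pts (@icone R d E) a ->
  lattice_pts (@icone R d E) b -> lattice_pts (@icone R d E) (a + b).
Proof. by rewrite /lattice_pts /= toRD; exact: cone_hullD. Qed.

(** The sum of the half-space normals serves as [l]: if it vanishes at [a], every normal does, so
    [- a] lies in the cone as well. *)
Lemma icone_height E : strongly_convex (@icone R d E) ->
  exists l : 'rV[int]_d, forall a, lattice_pts (@icone R d E) a -> a <> 0 ->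
    0 < ipair l a.
Proof.
move=> Epointed; have [F EF] := @icone_halfspaces R d E.
exists (\sum_(f <- F) f) => a Ea an0.
rewrite -(ltr0z R) -pairing_toR pairingC toR_sum pairing_sumr.
have F0 f : f \in F -> 0 <= pairing (toR a) (toR f) :> R by exact: (EF _).1 Ea f.
rewrite lt_neqAle big_seq sumr_ge0 // andbT; apply/negP => /eqP.
rewrite -big_seq => /esym sum0.
apply: an0; apply: (@toR_inj R); rewrite toR0; apply: Epointed => //.
apply/EF => f fF; rewrite pairingNl oppr_ge0.
move: sum0; rewrite (big_rem f fF) /= => /eqP; rewrite paddr_eq0 ?F0 //.
  by move=> /andP[/eqP->].
by rewrite big_seq sumr_ge0 // => g /mem_rem; exact: F0.
Qed.

(** Induction on the height: a nonzero reducible point is a sum of two points of smaller height. *)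
Lemma irreducible_gen E : strongly_convex (@icone R d E) ->
  forall a, lattice_pts (@icone R d E) a ->
    exists2 s : seq 'rV[int]_d, forall b, b \in s -> irreducible_in (@icone R d E) b
      & a = \sum_(b <- s) b.
Proof.
move=> Epointed a; have [l lpos] := icone_height Epointed.
have lD b c : ipair l (b + c) = ipair l b + ipair l c.
  by rewrite /ipair linearD mulmxDr mxE.
have [n] := ubnP `|ipair l a|%N; elim: n a => // n IH a la Ea.
have [a0|/eqP an0] := eqVneq a 0; first by exists [::]; rewrite ?big_nil.
have [airr|] := pselect (irreducible_in (icone E) a).
  by exists [:: a]; rewrite ?big_seq1 // => b; rewrite inE => /eqP->.
move=> /not_and3P[//|//|/existsNP[b /existsNP[c]]].
move=> /not_implyP[Eb /not_implyP[Ec /not_implyP[abc /not_orP[bn0 cn0]]]].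
have lb := lpos _ Eb bn0; have lc := lpos _ Ec cn0; have labc := lD b c.
have [||sb sbirr bE] := IH b; [by move: la; rewrite abc; lia | by [] |].
have [||sc scirr cE] := IH c; [by move: la; rewrite abc; lia | by [] |].
exists (sb ++ sc); last by rewrite big_cat -bE -cE.
by move=> x; rewrite mem_cat => /orP[/sbirr|/scirr].
Qed.

(** When an irreducible is written as a sum of generators, the first term or the sum of the others
    vanishes; dropping the vanishing part again and again leaves a single generator. *)
Lemma irreducible_sub_generators C (A : set 'rV[int]_d) : lattice_pts C 0 ->
  (forall a b, lattice_pts C a -> lattice_pts C b -> lattice_pts C (a + b)) ->
  generates_semigroup C A -> irreducible_in C `<=` A.
Proof.
move=> C0 CD [AC Agen] a [Ca an0 airr].
have [s sA asum] := Agen a Ca.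
elim: s sA asum => [|b s IH] sA; first by rewrite big_nil.
rewrite big_cons => abs.
have Cs : lattice_pts C (\sum_(j <- s) j).
  rewrite big_seq; elim/big_ind: _ => // i si; apply: AC; apply: sA.
  by rewrite /= inE si orbT.
have Ab : A b by apply: sA; rewrite /= mem_head.
have [||b0|s0] := airr b _ _ _ abs; [exact: AC | exact: Cs | |].
  apply: IH; first by move=> i si; apply: sA; rewrite /= inE [i \in s]si orbT.
  by rewrite {1}abs b0 add0r.
by rewrite abs s0 addr0.
Qed.

Lemma icone_irreducible_hilbert E :
  irreducible_in (@icone R d E) `<=` hilbert_basis (@icone R d E).
Proof.
move=> a airr A Agen; apply: irreducible_sub_generators airr => //.
  exact: icone0.
exact: icone_latD.
Qed.

Lemma hilbert_basisE E : strongly_convex (@icone R d E) ->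
  hilbert_basis (@icone R d E) = irreducible_in (@icone R d E).
Proof.
move=> Epointed; apply/seteqP; split; last exact: icone_irreducible_hilbert.
move=> a; apply; split=> [b [] //|m Em].
by have [s sirr ->] := irreducible_gen Epointed Em; exists s.
Qed.

(** Lattice points of the cube [[-B, B]^d], indexed by a finite type with [(2 B + 1)^d] elements.
    The indexing gives finiteness here and the count of characters in [chain_length]. *)
Definition box (B : nat) (t : {ffun 'I_d -> 'I_(B.*2.+1)}) : 'rV[int]_d :=
  \row_j ((t j)%:Z - B%:Z).

Lemma boxP B a : (forall j, `|a 0 j| <= B%:Z) -> exists t, a = box (B := B) t.
Proof.
move=> aB.
exists [ffun j => inord (absz (a 0 j + B%:Z)%R)].
apply/rowP => j; rewrite mxE ffunE inordK; have := aB j; lia.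
Qed.

(** Gordan's argument: a nonzero generator with coefficient at least 1 could be split off, so an
    irreducible that is not itself a generator has coefficients below 1 on all nonzero generators.
    This bounds its entries. *)
Lemma irreducible_finite E : exists s : seq 'rV[int]_d,
  forall a, irreducible_in (@icone R d E) a -> a \in s.
Proof.
pose B := \sum_(e <- E) \sum_j absz (e 0 j).
exists (E ++ [seq box t | t : {ffun 'I_d -> 'I_(B.*2.+1)}]) => a [Ea an0 airr].
rewrite mem_cat; apply/orP; have [c c0 acE] := icone_coef Ea.
have [aE|/negP aE] := boolP (a \in E); [by left | right].
have cle i j : `|c i * (nth 0 E i 0 j)%:~R| <= (absz (nth 0 E i 0 j))%:R.
  have iE : nth 0 E i \in E by rewrite mem_nth.
  have [c1|c1] := ltP (c i) 1.
    rewrite normrM (ger0_norm (c0 i)) -intr_norm natr_absz ler_piMl //.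
    exact: ltW.
  suff -> : nth 0 E i = 0 by rewrite mxE mulr0 normr0.
  have [||||aeq] := airr (nth 0 E i) (a - nth 0 E i) => //.
  - exact: icone_gen.
  - rewrite /lattice_pts /= toRB acE (bigD1 i) //= addrAC.
    rewrite -{2}[toR (nth 0 E i)]scale1r -scalerBl.
    apply: cone_hullD.
      by apply: cone_hullZ; [rewrite subr_ge0 | exact: icone_gen].
    apply: cone_hull_sum => k _; apply: cone_hullZ => //; apply: icone_gen.
    by rewrite mem_nth.
  - by rewrite addrC subrK.
  - by case: aE; rewrite -(subrK (nth 0 E i) a) aeq add0r.
have aB j : `|a 0 j| <= B%:Z.
  rewrite -(ler_int R) intr_norm.
  have -> : (a 0 j)%:~R = \sum_i c i * (nth 0 E i 0 j)%:~R :> R.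
    have := congr1 (fun v : 'rV[R]_d => v 0 j) acE; rewrite /toR mxE => ->.
    by rewrite summxE; apply: eq_bigr => i _; rewrite !mxE.
  apply: le_trans (ler_norm_sum _ _ _) _.
  apply: le_trans (ler_sum _ (fun i _ => cle i j)) _.
  rewrite -natr_sum pmulrn ler_int lez_nat /B (big_nth 0) big_mkord.
  by apply: leq_sum => i _; rewrite (bigD1 j) //= leq_addr.
by have [t ->] := boxP aB; apply/mapP; exists t; rewrite ?mem_enum.
Qed.

End Irreducible.

(** * The polyhedron of the Nash blowup *)

Section Convex.
Context {R : realType} {d : nat}.
Implicit Types (A C : set 'rV[R]_d).

Lemma convex_setP C : convex_set C <-> forall (x y : 'rV[R]_d) (l : R),
  C x -> C y -> 0 <= l -> l <= 1 -> C (l *: x + (1 - l) *: y).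
Proof.
split=> [Ccvx x y l Cx Cy l0 l1|Ccvx].
  have xC : x \in C by rewrite inE.
  have yC : y \in C by rewrite inE.
  have l01 : 0 <= l <= 1 by rewrite l0.
  have := Ccvx x y (Itv01 l0 l1) xC yC.
  by rewrite inE.
move=> x y l; rewrite !inE => Cx Cy; apply: Ccvx => //.
Qed.

Lemma convex_setD1 C (l : 'rV[R]_d) (b : R) : convex_set C ->
  convex_set (C `&` [set v | b < pairing l v]).
Proof.
move=> /convex_setP Ccvx; apply/convex_setP => x y t [Cx bx] [Cy bY] t0 t1.
split; first exact: Ccvx.
rewrite /= pairingDr !pairingZr; move: bx bY => /=.
set X := pairing l x; set Y := pairing l y => bx bY.
have [->|tn0] := eqVneq t 0; first by rewrite mul0r add0r subr0 mul1r.
have : 0 < t * (X - b) by rewrite mulr_gt0 ?subr_gt0 // lt_neqAle eq_sym tn0.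
have : 0 <= (1 - t) * (Y - b) by rewrite mulr_ge0 ?subr_ge0 // ltW.
by rewrite !mulrBr !mulrBl !mul1r; move: (t * X) (t * Y) (t * b) => p q r; lra.
Qed.

Lemma convex_conv_hull A : convex_set (conv_hull A).
Proof.
apply/convex_setP => x y l Ax Ay l0 l1 B [Bcvx AB].
by move/convex_setP: (Bcvx); apply=> //; [exact: Ax | exact: Ay].
Qed.

Lemma sub_conv_hull A : A `<=` conv_hull A.
Proof. by move=> x Ax B [_]; apply. Qed.

Lemma conv_hull_min A C : convex_set C -> A `<=` C -> conv_hull A `<=` C.
Proof. by move=> Ccvx AC x; apply. Qed.

(** Membership is asked only for positive weights, because in the exchange argument a zero weight
    belongs to a family of determinant 0. The induction normalises partial sums, as the weights of a
    tail no longer add up to 1. *)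
Lemma convex_sum C (I : Type) (r : seq I) (l : I -> R) (x : I -> 'rV[R]_d) :
  convex_set C -> (forall i, 0 <= l i) -> (forall i, 0 < l i -> C (x i)) ->
  \sum_(i <- r) l i = 1 -> C (\sum_(i <- r) l i *: x i).
Proof.
move=> /convex_setP Ccvx l0 Cx l1.
suff H : forall s, \sum_(i <- s) l i != 0 ->
    C ((\sum_(i <- s) l i)^-1 *: \sum_(i <- s) l i *: x i).
  by have := H r; rewrite l1 oner_eq0 invr1 scale1r; exact.
elim=> [|i s IH]; first by rewrite big_nil eqxx.
rewrite !big_cons; set L := \sum_(j <- s) l j.
have L0 : 0 <= L by rewrite sumr_ge0.
have [LE|Ln0] := eqVneq L 0.
  have -> : \sum_(j <- s) l j *: x j = 0.
    move: LE; rewrite /L; elim: (s) => [|j t IHt]; first by rewrite !big_nil.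
    rewrite !big_cons => /eqP; rewrite paddr_eq0 ?sumr_ge0 // => /andP[/eqP-> /eqP/IHt->].
    by rewrite scale0r addr0.
  rewrite LE !addr0 => li; rewrite scalerA mulVf // scale1r.
  by apply: Cx; rewrite lt_neqAle eq_sym li l0.
have [li|lin0] := eqVneq (l i) 0.
  by rewrite li scale0r !add0r => _; exact: IH.
move=> _; have Lpos : 0 < L by rewrite lt_neqAle eq_sym Ln0 L0.
have lipos : 0 < l i by rewrite lt_neqAle eq_sym lin0 l0.
have := Ccvx _ _ (l i / (l i + L)) (Cx i lipos) (IH Ln0).
rewrite -/L; set W := \sum_(j <- s) _.
have -> : (l i / (l i + L)) *: x i + (1 - l i / (l i + L)) *: (L^-1 *: W) =
  (l i + L)^-1 *: (l i *: x i + W).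
  rewrite scalerDr !scalerA; congr (_ *: _ + _ *: _); first by rewrite mulrC.
  by field; rewrite Ln0 /= gt_eqF // addr_gt0.
apply; first by rewrite divr_ge0 // ltW // addr_gt0.
by rewrite ler_pdivrMr ?addr_gt0 // mul1r lerDl.
Qed.

End Convex.

(** Cramer's rule for rows. Expanding along the new row, the rows of [A] other than [j] contribute
    off-diagonal entries of [A *m \adj A], which vanish. *)
Lemma det_replace_row (F : comNzRingType) n (A : 'M[F]_n) (j : 'I_n) (c : 'rV_n) :
  \det (\matrix_i (if i == j then c *m A else row i A)) = c 0 j * \det A.
Proof.
set B := \matrix_i _.
have cofE k : cofactor B j k = cofactor A j k.
  rewrite /cofactor; congr (_ * \det _); apply/matrixP => i l.
  by rewrite !mxE [lift _ _ == _]eq_sym (negbTE (neq_lift _ _)) mxE.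
rewrite (expand_det_row _ j).
under eq_bigr => k _ do rewrite cofE mxE eqxx mxE big_distrl /=.
rewrite exchange_big /= (bigD1 j) //= [X in _ + X]big1 ?addr0 => [|i ij].
  rewrite (expand_det_row A j) mulr_sumr.
  by apply: eq_bigr => k _; rewrite -mulrA.
have := congr1 (fun M : 'M[F]_n => M i j) (mul_mx_adj A).
rewrite !mxE (negbTE ij) mulr0n => AadjA.
rewrite -[RHS](mulr0 (c 0 i)) -{2}AadjA mulr_sumr.
by apply: eq_bigr => k _; rewrite [\adj A k j]mxE -mulrA.
Qed.

(** * Simplicial cones and unimodularity *)

Section Simplicial.
Context {R : realType} {d : nat}.
Implicit Types (h : 'I_d -> 'rV[int]_d).

(** The [h i] are rows here and columns in [detp]; with rows, a linear combination of the [h i] is a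
    product with a coefficient row on the left. *)
Definition detr h : int := \det (\matrix_i h i).

Definition simp_cone h : set 'rV[R]_d := icone [seq h i | i : 'I_d].

Lemma simp_coneP h v : simp_cone h v <->
  exists2 c : 'I_d -> R, forall i, 0 <= c i & v = \sum_i c i *: toR (h i).
Proof.
split; last first.
  move=> [c c0 ->]; apply: cone_hull_sum => i _; apply: cone_hullZ => //.
  by apply: icone_gen; apply/mapP; exists i; rewrite ?mem_enum.
move: v; apply: cone_hull_min.
- by exists (fun=> 0) => //; rewrite big1 // => i _; exact: scale0r.
- move=> u v [c c0 ->] [c' c'0 ->]; exists (fun i => c i + c' i).
    by move=> i; exact: addr_ge0.
  by rewrite -big_split; apply: eq_bigr => i _; rewrite scalerDl.
- move=> k u k0 [_ /mapP[i _ ->] <-].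
  exists (fun j => if j == i then k else 0); first by move=> j; case: ifP.
  rewrite (bigD1 i) //= eqxx big1 ?addr0 //.
  by move=> j /negbTE->; rewrite scale0r.
Qed.

Lemma simp_comb h (c : 'I_d -> R) :
  \sum_i c i *: toR (h i) = (\row_i c i) *m map_mx intr (\matrix_i h i).
Proof.
rewrite mulmx_sum_row; apply: eq_bigr => i _; rewrite mxE.
by congr (_ *: _); apply/rowP => k; rewrite !mxE.
Qed.

Lemma simp_indep h (c : 'I_d -> R) : detr h != 0 ->
  \sum_i c i *: toR (h i) = 0 -> forall i, c i = 0.
Proof.
move=> dn0; rewrite simp_comb => c0 i.
have Hu : map_mx intr (\matrix_i h i) \in (@unitmx R d).
  by rewrite unitmxE det_map_mx unitfE intr_eq0.
have := congr1 (mulmx^~ (invmx (map_mx intr (\matrix_i h i)))) c0.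
by rewrite mulmxK // mul0mx => /rowP/(_ i); rewrite !mxE.
Qed.

Lemma simp_pointed h : detr h != 0 -> strongly_convex (simp_cone h).
Proof.
move=> dn0 v /simp_coneP[c c0 vc] /simp_coneP[c' c'0 vc'].
have cc' : \sum_i (c i + c' i) *: toR (h i) = 0 :> 'rV[R]_d.
  under eq_bigr do rewrite scalerDl.
  by rewrite big_split /= -vc -vc' subrr.
have := simp_indep dn0 cc' => cc0.
rewrite vc big1 // => i _; move/eqP: (cc0 i).
by rewrite paddr_eq0 // => /andP[/eqP-> _]; rewrite scale0r.
Qed.

(** This makes every unit vector a difference of two lattice points of the cone. By the adjugate,
    the coordinates of a unit vector in the [h i] are entries of [\adj H] divided by a determinant
    of absolute value at least 1, so the sum of all these absolute entries is a sufficient [N]. *)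
Lemma simp_unit_shift h : detr h != 0 -> exists N : nat, forall k,
  simp_cone h (toR (delta_mx 0 k + (\sum_i h i) *+ N)).
Proof.
move=> dn0; pose H := \matrix_i h i.
pose D : R := (detr h)%:~R; have Dn0 : D != 0 by rewrite intr_eq0.
pose N := (\sum_k \sum_i absz ((\adj H) k i))%N.
exists N => k; apply/simp_coneP.
have adjN i : (absz ((\adj H) k i) <= N)%N.
  by rewrite /N (bigD1 k) //= (bigD1 i) //= -addnA leq_addr.
exists (fun i => (\adj H k i)%:~R / D + N%:R).
  move=> i; rewrite -lerBlDr sub0r.
  have : `|(\adj H k i)%:~R / D| <= N%:R.
    rewrite normrM normfV -(ler_pM2r (x := `|D|)) ?normr_gt0 //.
    rewrite divfK ?normr_eq0 //; apply: le_trans (_ : N%:R * 1 <= _).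
      by rewrite mulr1 -intr_norm pmulrn ler_int; have := adjN i; lia.
    apply: ler_wpM2l => //; rewrite -intr_norm ler1z.
    by move: dn0; lia.
  by rewrite ler_norml => /andP[].
under [RHS]eq_bigr do rewrite scalerDl.
rewrite big_split /= -scaler_sumr -toR_sum -toRMn toRD; congr (_ + _).
apply: (scalerI Dn0); rewrite scaler_sumr.
under [RHS]eq_bigr do rewrite scalerA mulrCA divff // mulr1 -toRZ.
rewrite -toRZ -toR_sum; congr toR.
have := congr1 (row k) (mul_adj_mx H); rewrite row_mul mulmx_sum_row.
rewrite -scalemx1 linearZ /= row1 => <-.
by apply: eq_bigr => i _; rewrite !mxE rowK.
Qed.

(** Under the hypothesis the [h i] generate all lattice points of the cone, whose differences
    include the unit vectors; so the matrix of the [h i] has an integral inverse. The contrapositive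
    supplies the vector to be exchanged. *)
Lemma unimodular_of_irreducibles h : detr h != 0 ->
  (forall a, irreducible_in (simp_cone h) a -> exists i, a = h i) ->
  `|detr h| = 1.
Proof.
move=> dn0 irrh; have [N Nh] := simp_unit_shift dn0.
have span a : lattice_pts (simp_cone h) a -> exists x, a = x *m (\matrix_i h i).
  move=> ha; have [s sirr ->] := irreducible_gen (simp_pointed dn0) ha.
  elim: s sirr => [|b s IH] sirr; first by exists 0; rewrite big_nil mul0mx.
  have [i bi] := irrh b (sirr b (mem_head _ _)).
  have [|y yE] := IH; first by move=> c cs; apply: sirr; rewrite inE cs orbT.
  exists (delta_mx 0 i + y); rewrite big_cons mulmxDl -rowE rowK -bi yE //.
have /choice[X XE] : forall k, exists x : 'rV[int]_d,
    delta_mx 0 k = x *m (\matrix_i h i).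
  move=> k; have [x xE] := span _ (Nh k).
  exists (x - const_mx 1 *+ N); rewrite mulmxBl -xE.
  have -> : (const_mx 1 *+ N : 'rV[int]_d) *m (\matrix_i h i) = (\sum_i h i) *+ N.
    rewrite -!scaler_nat -scalemxAl; congr (_ *: _).
    by rewrite mulmx_sum_row; apply: eq_bigr => i _; rewrite mxE scale1r rowK.
  by rewrite addrK.
have : (\matrix_k X k) *m (\matrix_i h i) = 1%:M.
  by apply/row_matrixP => k; rewrite row_mul rowK -XE row1.
move/(congr1 determinant); rewrite det_mulmx det1 -/(detr h) => dd.
move/(congr1 absz): dd; rewrite abszM => /eqP; rewrite muln_eq1 => /andP[_ /eqP].
by lia.
Qed.

End Simplicial.

(** * Exchange of basis vectors and independence of the characteristic *)

Section Nash.
Context {R : realType} {d : nat}.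
Implicit Types (h : 'I_d -> 'rV[int]_d) (C tau : set 'rV[R]_d).

(* A compact face cannot contain all multiples of g, so its supporting
   functional takes a positive value on it. *)
Lemma Gamma_support C g : lattice_pts C g -> g <> 0 ->
  (forall n, (0 < n)%N -> lattice_pts C (g *+ n)) -> lattice_pts (Gamma C) g ->
  exists u (b : R), [/\ 0 < b, pairing u (toR g) = b
    & forall m, lattice_pts C m -> m <> 0 -> b <= pairing u (toR m)].
Proof.
move=> Cg gn0 Cgn [F [[u [b [ubF FE]]] Fcompact] Fg].
have ub m : lattice_pts C m -> m <> 0 -> b <= pairing u (toR m).
  by move=> Cm mn0; apply: ubF; apply: sub_conv_hull; exists m.
have ugb : pairing u (toR g) = b by move: Fg; rewrite FE => -[].
have gMn0 n : (0 < n)%N -> g *+ n <> 0.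
  move=> n0 /rowP gn; apply: gn0; apply/rowP => j; move: (gn j).
  by rewrite mulmxnE !mxE => /eqP; rewrite mulrn_eq0 eqn0Ngt n0 /= => /eqP.
exists u, b; split=> //.
(* Doubling [g] excludes [b < 0]; for [b = 0] all positive multiples of [g] would lie on the bounded
   face. *)
have : b <= b * 2.
  have := ub (g *+ 2) (Cgn 2 isT) (gMn0 2 isT).
  by rewrite toRMn pairingZr ugb mulrC.
have [b0|//|b0 _] := ltrgtP b 0; first by lra.
have gF n : (0 < n)%N -> F (n%:R *: toR g).
  move=> n0; rewrite FE -toRMn; split; last first.
    by rewrite /= toRMn pairingZr ugb b0 mulr0.
  by apply: sub_conv_hull; exists (g *+ n) => //; split; [exact: Cgn | exact: gMn0].
have [M [_ MF]] := compact_bounded Fcompact.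
have gnorm : 0 < `|toR g : 'rV[R]_d|.
  by rewrite normr_gt0; apply/eqP => g0; apply: gn0; apply: (@toR_inj R); rewrite toR0.
have /MF MF1 : M < `|M| + 1 by rewrite (le_lt_trans (ler_norm M)) // ltrDl.
pose n := (Num.truncn ((`|M| + 1) / `|toR g : 'rV[R]_d|)).+1.
have := MF1 _ (gF n isT); rewrite /= normrZ normr_nat.
rewrite -ler_pdivlMr // leNgt => /negP; elim.
by apply: truncnS_gt.
Qed.

Lemma lattice_ptsMn E (g : 'rV[int]_d) n :
  lattice_pts (@icone R d E) g -> lattice_pts (@icone R d E) (g *+ n).
Proof.
by move=> Eg; rewrite /lattice_pts /= toRMn; apply: cone_hullZ.
Qed.

Lemma hilbert_basis_lattice C :
  hilbert_basis C `<=` lattice_pts C.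
Proof.
move=> a; apply; split=> // m Cm; exists [:: m]; last by rewrite big_seq1.
by move=> x; rewrite /= inE => /eqP->.
Qed.

Lemma detr_neq0 h i : detr h != 0 -> h i <> 0.
Proof.
move=> dn0 hi; move/negP: dn0; apply.
rewrite /detr -(mul1r (\det _)) (expand_det_row _ i) mulr_sumr big1 // => j _.
by rewrite mxE hi mxE mul0r mulr0.
Qed.

Definition replace h (j : 'I_d) g : 'I_d -> 'rV[int]_d :=
  fun i => if i == j then g else h i.

Lemma detr_replace h j g (c : 'I_d -> R) :
  toR g = \sum_i c i *: toR (h i) ->
  (detr (replace h j g))%:~R = c j * (detr h)%:~R :> R.
Proof.
move=> gE; rewrite /detr -!det_map_mx.
have -> : c j = (\row_i c i) 0 j by rewrite mxE.
rewrite -det_replace_row -simp_comb -gE; congr determinant.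
by apply/matrixP => i k; rewrite !mxE /replace; case: eqP => _; rewrite !mxE.
Qed.

Lemma sum_replace h j g : \sum_i replace h j g i = \sum_i h i - h j + g.
Proof.
rewrite (bigD1 j) //= (bigD1 j (P := predT)) //= /replace eqxx.
rewrite (eq_bigr h) => [|i /negbTE-> //].
by rewrite [h j + _]addrC addrK addrC.
Qed.

Lemma nonunimodular_step tau h : (exists E, tau = icone E) -> G_stable tau ->
  (forall i, hilbert_basis tau (h i)) -> detr h != 0 -> `|detr h| != 1 ->
  exists g (c : 'I_d -> R), [/\ hilbert_basis tau g, forall i, 0 <= c i < 1,
    toR g = \sum_i c i *: toR (h i), \sum_i c i <= 1 & 0 < \sum_i c i].
Proof.
move=> [E tauE] [stab1 stab2] Gh dn0 dn1.
have Gtau := @hilbert_basis_lattice tau.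
have [g [girr gh]] : exists g, irreducible_in (@simp_cone R d h) g /\ forall i, g <> h i.
  apply: contrapT => /forallNP H; move/eqP: dn1; apply.
  apply: (@unimodular_of_irreducibles R d h dn0) => a airr.
  by apply: contrapT => /forallNP ah; apply: (H a).
have [gcone gn0 _] := girr.
have Ag : [set` [seq h i | i : 'I_d]] `<=` hilbert_basis tau.
  by move=> _ /mapP[i _ ->].
have Gg : hilbert_basis tau g.
  have := icone_irreducible_hilbert girr.
  by rewrite -[icone _]/(cone_of [set` [seq h i | i : 'I_d]]) stab2 // => -[].
have [c c0 gE] := (simp_coneP _ _).1 gcone.
have [||||u [b [b0 ug ub]]] := @Gamma_support tau g.
- exact: Gtau.
- by [].
- by move=> n _; have := Gtau _ Gg; rewrite tauE; apply: lattice_ptsMn.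
- by rewrite -stab1.
(* [u] takes the value [b] at [g] and at least [b] at every [h i]. *)
have csum : \sum_i c i <= 1.
  rewrite -(ler_pM2r b0) mul1r -{2}ug gE pairing_sumr mulr_suml.
  apply: ler_sum => i _; rewrite pairingZr ler_wpM2l // ub //; first exact: Gtau.
  exact: detr_neq0.
exists g, c; split=> //.
(* A coefficient that reaches 1 exhausts the sum, and then [g = h i]. *)
- move=> i; rewrite c0 ltNge; apply/negP => ci1; apply: (gh i).
  have sum0 : \sum_(j | j != i) c j = 0.
    apply/le_anti; rewrite sumr_ge0 // andbT.
    by move: csum; rewrite (bigD1 i) //=; move: (\sum_(j | _) _) => x; lra.
  have ci : c i = 1.
    by move: csum; rewrite (bigD1 i) //= sum0 addr0; move: ci1; lra.
  apply: (@toR_inj R); rewrite gE (bigD1 i) //= ci scale1r big1 ?addr0 // => j ji.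
  have := psumr_eq0P (fun j _ => c0 j) sum0 => /(_ j ji) ->.
  by rewrite scale0r.
- rewrite lt_neqAle sumr_ge0 // andbT; apply/negP => /eqP/esym sum0.
  apply: gn0; apply: (@toR_inj R); rewrite gE toR0 big1 // => i _.
  by rewrite (psumr_eq0P (fun j _ => c0 j) sum0) // scale0r.
Qed.

Lemma detp0E h p : detp p h = modz (detr h) p.
Proof.
rewrite /detp /detr -det_tr; congr (modz (\det _) _).
by apply/matrixP => i j; rewrite !mxE.
Qed.

Lemma nash_polyhedron_charfree (sigma : set 'rV[R]_d) p :
  rational_polyhedral_cone sigma -> G_stable (dual_cone sigma) -> prime p ->
  nash_polyhedron p sigma = nash_polyhedron 0 sigma.
Proof.
move=> [s sigmaE] stab pp.
have [E tauE] : exists E, dual_cone sigma = icone E.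
  by rewrite sigmaE; exact: dual_icone.
set tau := dual_cone sigma in stab tauE *.
rewrite /nash_polyhedron -/tau; apply/seteqP; split; apply: conv_hull_min.
- exact: convex_conv_hull.
- move=> v [h [Gh dn0 tauh]]; apply: sub_conv_hull; exists h; split=> //.
  by move: dn0; rewrite !detp0E modz0; apply: contra => /eqP->; rewrite mod0z.
- exact: convex_conv_hull.
move=> _ [h [Gh + [w + ->]]]; rewrite detp0E modz0.
(* [w] stays general in the induction: the exchanged families come with the additional term
   [(L^-1 - 1) *: toR g], which lies in [tau] because [L <= 1]. *)
have [n] := ubnP `|detr h|%N; elim: n h Gh w => // n IH h Gh w dn dn0 tauw.
have [d1|dn1] := eqVneq `|detr h| 1.
  apply: sub_conv_hull; exists h; split=> //; last by exists w.
  rewrite detp0E; apply/negP => /eqP/dvdz_mod0P; rewrite dvdzE /=.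
  have -> : absz (detr h) = 1%N by lia.
  by rewrite dvdn1 => /eqP p1; rewrite p1 in pp.
have [g [c [Gg c01 gE csum cpos]]] := nonunimodular_step (ex_intro _ E tauE) stab Gh dn0 dn1.
pose L := \sum_i c i.
have Ln0 : L != 0 by rewrite gt_eqF.
have taug : tau (toR g) by exact: hilbert_basis_lattice Gg.
have -> : toR (\sum_i h i) + w =
    \sum_i (c i / L) *: (toR (\sum_k replace h i g k) + (w + (L^-1 - 1) *: toR g)).
  under [RHS]eq_bigr do rewrite sum_replace toRD toRB -!addrA addrCA.
  have sL : \sum_i c i / L = 1 by rewrite -mulr_suml divff.
  have -> : \sum_i (c i / L) *: (- toR (h i) + (toR (\sum_k h k) +
      (toR g + (w + (L^-1 - 1) *: toR g)))) =
      - (L^-1 *: toR g) + (toR (\sum_k h k) + (toR g + (w + (L^-1 - 1) *: toR g))).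
    under [LHS]eq_bigr do rewrite scalerDr.
    rewrite big_split /= -scaler_suml sL scale1r; congr (_ + _).
    rewrite gE scaler_sumr -sumrN; apply: eq_bigr => i _.
    by rewrite scalerN scalerA mulrC.
  rewrite scalerBl scale1r.
  by apply/rowP => j; rewrite !mxE; ring.
apply: convex_sum.
- exact: convex_conv_hull.
- by move=> i; have /andP[ci0 _] := c01 i; rewrite divr_ge0 // ltW.
- move=> i; rewrite pmulr_lgt0 ?invr_gt0 // => cipos.
  have dE := detr_replace i gE; have /andP[_ ci1] := c01 i.
  apply: IH.
  + by move=> k; rewrite /replace; case: eqP.
  + rewrite -(ltr_nat R) !natr_absz intr_norm.
    apply: (@lt_le_trans _ _ (`|(detr h)%:~R : R|)); last first.
      by rewrite -intr_norm -natr_absz ler_nat -ltnS.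
    by rewrite dE normrM (gtr0_norm cipos) gtr_pMl // normr_gt0 intr_eq0.
  + by rewrite -(intr_eq0 R) dE mulf_neq0 ?intr_eq0 // gt_eqF.
  + apply: dual_coneD => //; apply: dual_coneZ => //.
    by rewrite subr_ge0 invf_ge1.
- by rewrite -mulr_suml divff.
Qed.

End Nash.

(** * Its normal fan *)

Section Fan.
Context {R : realType} {d : nat}.
Implicit Types (h : 'I_d -> 'rV[int]_d) (g C tau : set 'rV[R]_d).

(* The hyperplane a = 0 separates g from g' and meets g' in the common face
   [g `&` g']. *)
Definition polyhedral_fan (Sigma : set (set 'rV[R]_d)) : Prop :=
  (forall g, Sigma g -> exists F, g = icone F) /\
  forall g g', Sigma g -> Sigma g' -> exists a : 'rV[int]_d,
    [/\ dual_semigroup g' a, dual_semigroup g (- a)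
      & forall u, g' u -> pairing u (toR a) = 0 -> g u].

Lemma dual_icone_seq (E : seq 'rV[int]_d) (u : 'rV[R]_d) :
  dual_cone (icone E) u <-> forall e, e \in E -> 0 <= pairing u (toR e).
Proof.
rewrite /icone dual_cone_hull; split=> [Eu e eE|Eu _ [e eE <-]]; last exact: Eu.
by apply: Eu; exists e.
Qed.

Section Vertices.
Variables (tau : set 'rV[R]_d) (Ss Gs : seq 'rV[int]_d).
Hypothesis tauE : tau = icone Gs.

Let T : set 'rV[R]_d := [set v | exists2 m, m \in Ss & exists2 w, tau w & v = toR m + w].
Let Q := conv_hull T.

(** Generators of the tangent cone of [Q] at [m]: the differences to all members of [Ss], and the
    recession directions. *)
Definition edges (m : 'rV[int]_d) := [seq m' - m | m' <- Ss] ++ Gs.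

Lemma edges_sums m m' : m' \in Ss -> m' - m \in edges m.
Proof.
by move=> m'S; rewrite mem_cat; apply/orP; left; apply/mapP; exists m'.
Qed.

Lemma edges_gens m e : e \in Gs -> e \in edges m.
Proof. by move=> eG; rewrite mem_cat eG orbT. Qed.

(** A vertex outside [T] would leave [T], hence its hull, in the open half-space above the vertex.
    So [v = m + w], and as [m + 2 w] also lies in [Q], [u] is nonnegative on [w]; thus [m] already
    attains the minimum, and the minimum is attained only once. *)
Lemma vertex_in_sums v : vertex Q v -> exists2 m, m \in Ss & v = toR m.
Proof.
move=> [u [b [ub vE]]].
have [Qv uv] : Q v /\ pairing u v = b by have : [set v] v by []; rewrite vE => -[].
have uniq w : Q w -> pairing u w <= b -> w = v.
  move=> Qw uw; have : [set v] w.
    by rewrite vE; split => //; apply/le_anti; rewrite uw ub.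
  by [].
have [m mS [w tw vmw]] : T v.
  apply: contrapT => Tv.
  suff : (Q `&` [set w | b < pairing u w]) v by move=> [_ /=]; rewrite uv ltxx.
  apply: (@conv_hull_min R d T) Qv; first exact: convex_setD1 (@convex_conv_hull _ _ _).
  move=> w Tw; have Qw : Q w by exact: sub_conv_hull.
  split=> //=; rewrite ltNge; apply/negP => uw; apply: Tv.
  by rewrite -(uniq w Qw uw).
exists m => //.
have tau2w : tau (2 *: w) by move: tw; rewrite tauE; exact: cone_hullZ.
have Q1 : Q (toR m).
  apply: sub_conv_hull; exists m => //; exists 0; last by rewrite addr0.
  by rewrite tauE; exact: cone_hull0.
have Q2 : Q (toR m + 2 *: w).
  by apply: sub_conv_hull; exists m => //; exists (2 *: w).
apply/esym/uniq => //.
have := ub _ Q2; move: uv; rewrite vmw !pairingDr pairingZr.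
by move: (pairing u (toR m)) (pairing u w) => x y; lra.
Qed.

Lemma vertex_coneE m : m \in Ss ->
  vertex_cone Q (toR m) = dual_cone (icone (edges m)).
Proof.
move=> mS; apply/seteqP; split=> u.
  move=> /dual_cone_hull Vu; apply/dual_icone_seq => e.
  rewrite mem_cat => /orP[/mapP[m' m'S ->]|eG].
    apply: Vu; exists (toR m'); last by rewrite toRB.
    apply: sub_conv_hull; exists m' => //; exists 0; last by rewrite addr0.
    by rewrite tauE; exact: cone_hull0.
  apply: Vu; exists (toR m + toR e); last by rewrite addrC addKr.
  apply: sub_conv_hull; exists m => //; exists (toR e) => //.
  by rewrite tauE; exact: icone_gen.
move=> /dual_icone_seq Eu; apply/dual_cone_hull => _ [w Qw <-].
rewrite pairingBr subr_ge0.
suff : Q `<=` [set w | pairing u (toR m) <= pairing u w] by exact.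
apply: conv_hull_min.
  apply/convex_setP => x y t /= xm ym t0 t1; rewrite pairingDr !pairingZr.
  have -> : pairing u (toR m) = t * pairing u (toR m) + (1 - t) * pairing u (toR m).
    by ring.
  by apply: lerD; apply: ler_wpM2l => //; rewrite subr_ge0.
move=> _ [m' m'S [w' tw' ->]] /=; rewrite pairingDr.
have h1 : 0 <= pairing u (toR (m' - m)).
  by apply: Eu; exact: edges_sums.
have h2 : 0 <= pairing u w'.
  suff Gu : dual_cone (icone Gs) u by apply: Gu; rewrite -tauE.
  by apply/dual_icone_seq => e eG; apply: Eu; exact: edges_gens.
by move: h1; rewrite toRB pairingBr; lra.
Qed.

(** The functional [u] attains its minimum on [Q] only at [m], so it is positive on every nonzero
    edge. *)
Lemma vertex_edges_pointed m : m \in Ss -> vertex Q (toR m) ->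
  strongly_convex (@icone R d (edges m)).
Proof.
move=> mS [u [b [ub vE]]].
have [Qv uv] : Q (toR m) /\ pairing u (toR m) = b.
  by have : [set @toR R d m] (toR m) by []; rewrite {1}vE => -[].
have uniq w : Q w -> pairing u w <= b -> w = toR m.
  move=> Qw uw; have : [set toR m] w.
    by rewrite vE; split => //; apply/le_anti; rewrite uw ub.
  by [].
have upos e : e \in edges m -> 0 <= pairing u (toR e) /\
    (pairing u (toR e) = 0 -> toR e = 0 :> 'rV[R]_d).
  move=> eE; have Qe : Q (toR m + toR e).
    move: eE; rewrite mem_cat => /orP[/mapP[m' m'S ->]|eG]; apply: sub_conv_hull.
      exists m' => //; exists 0; first by rewrite tauE; exact: cone_hull0.
      by rewrite toRB addrC subrK addr0.
    by exists m => //; exists (toR e) => //; rewrite tauE; exact: icone_gen.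
  have := ub _ Qe; rewrite pairingDr uv lerDl; split=> // u0.
  have := uniq _ Qe; rewrite pairingDr uv u0 addr0 lexx => /(_ isT).
  by rewrite -[X in _ = X]addr0 => /addrI.
move=> v Ev Env.
have u0 w : icone (edges m) w -> 0 <= pairing u w.
  by move: w; apply/dual_icone_seq => e /upos[].
have uv0 : pairing u v = 0.
  by apply/le_anti; rewrite u0 // andbT -oppr_ge0 -pairingNr u0.
have [c c0 vcE] := icone_coef Ev; rewrite vcE big1 // => i _.
have eE : nth 0 (edges m) i \in edges m by rewrite mem_nth.
have [ue0 uez] := upos _ eE.
have : \sum_i c i * pairing u (toR (nth 0 (edges m) i)) = 0.
  by rewrite -[RHS]uv0 [in RHS]vcE pairing_sumr; apply: eq_bigr => j _; rewrite pairingZr.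
move/psumr_eq0P => /(_ _ i isT) cu.
have /eqP := cu (fun j _ => mulr_ge0 (c0 j) (upos _ (mem_nth _ (ltn_ord j))).1).
rewrite mulf_eq0 => /orP[/eqP->|/eqP/uez->]; by rewrite ?scale0r ?scaler0.
Qed.

(** Adding [m - m'] turns the edge [n - m] at [m] into the edge [n - m'] at [m'], and a recession
    direction into a sum of two edges at [m']. These shifted edges are the material for separating
    characters. *)
Lemma edges_shift m m' e u : m \in Ss -> m' \in Ss -> e \in edges m ->
  dual_cone (@icone R d (edges m')) u ->
  0 <= pairing u (toR (m - m')) /\ 0 <= pairing u (toR (e + (m - m'))).
Proof.
move=> mS m'S eE /dual_icone_seq Eu.
have h1 : 0 <= pairing u (toR (m - m')) by apply: Eu; exact: edges_sums.
split=> //; move: eE; rewrite mem_cat => /orP[/mapP[n nS ->]|eG].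
  by rewrite addrA subrK; apply: Eu; exact: edges_sums.
rewrite toRD pairingDr addr_ge0 //; apply: Eu.
exact: edges_gens.
Qed.

Lemma normal_fan_polyhedral : polyhedral_fan (normal_fan Q).
Proof.
split=> [g|g g'] [v Vv [mR]].
  have [m mS ->] := vertex_in_sums Vv; rewrite vertex_coneE //.
  have [F FE] := @dual_icone R d (edges m); rewrite FE => /dual_icone_seq mF gE.
  exists [seq f <- F | pairing mR (toR f) == 0]; rewrite gE; apply/seteqP; split.
    move=> w [/icone_coef[c c0 ->]] /=; rewrite pairing_sumr.
    have cpos j : 0 <= pairing mR (c j *: toR (nth 0 F j)).
      by rewrite pairingZr mulr_ge0 // mF // mem_nth.
    move/psumr_eq0P => /(_ (fun j _ => cpos j)) c_eq0.
    apply: cone_hull_sum => i _.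
    have := c_eq0 i isT; rewrite pairingZr => /eqP; rewrite mulf_eq0 => /orP[/eqP->|fi].
      by rewrite scale0r; exact: cone_hull0.
    by apply: cone_hullZ => //; apply: icone_gen; rewrite mem_filter fi mem_nth.
  apply: cone_hull_min.
  - by split; [exact: cone_hull0 | rewrite /= pairing0r].
  - move=> x y [Fx x0] [Fy y0]; split; first exact: cone_hullD.
    by rewrite /= pairingDr x0 y0 addr0.
  - move=> k u k0 [f]; rewrite /= mem_filter => /andP[/eqP f0 fF] <-; split.
      by apply: cone_hullZ => //; exact: icone_gen.
    by rewrite /= pairingZr f0 mulr0.
have [m mS ->] := vertex_in_sums Vv; rewrite vertex_coneE //.
rewrite icone_bidual => /icone_coef[c c0 mRE] gE.
move=> [v' Vv' [mR']]; have [m' m'S ->] := vertex_in_sums Vv'; rewrite vertex_coneE //.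
move=> _ gE'.
pose e (i : 'I_(size (edges m))) := nth 0 (edges m) i.
have eE i : e i \in edges m by rewrite mem_nth.
(* The face [g] is cut out by [mR], a combination of the edges [e i]. On [g] the edges with positive
   coefficient vanish and [m - m'] is nonpositive, so the sum is nonpositive. On [g'] every term is
   nonnegative; if the sum vanishes at [u], so do [m - m'], which puts [u] in the vertex cone of
   [m], and the selected [e i], which puts it in [g]. *)
exists (\sum_(i < size (edges m) | 0 < c i) (e i + (m - m')) + (m - m')).
have g'0 u : g' u -> [/\ 0 <= pairing u (toR (m - m')),
    forall i, 0 <= pairing u (toR (e i + (m - m')))
  & dual_cone (icone (edges m')) u].
  rewrite gE' => -[ue _]; split=> // [|i]; last by have [] := edges_shift mS m'S (eE i) ue.
  by move/dual_icone_seq: ue; apply; exact: edges_sums.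
split.
- move=> u /g'0[h1 h2 _]; rewrite pairingC toRD pairingDr addr_ge0 //.
  by rewrite toR_sum pairing_sumr sumr_ge0.
- rewrite gE => u [ue /=]; rewrite mRE pairing_suml => cu0.
  have u0 i : 0 <= pairing (toR (e i)) u.
    by rewrite pairingC; move/dual_icone_seq: ue; apply.
  have cpos i : 0 <= pairing (c i *: toR (e i)) u by rewrite pairingZl mulr_ge0.
  have cz i : 0 < c i -> pairing u (toR (e i)) = 0.
    move=> ci; have /(_ i isT)/eqP := psumr_eq0P (fun i _ => cpos i) cu0.
    by rewrite pairingZl pairingC mulf_eq0 gt_eqF //= => /eqP.
  have um : pairing u (toR (m - m')) <= 0.
    rewrite -opprB toRN pairingNr oppr_le0.
    by move/dual_icone_seq: ue; apply; exact: edges_sums.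
  rewrite pairingC toRN pairingNr oppr_ge0 toRD pairingDr.
  rewrite -[leRHS]addr0 lerD // toR_sum pairing_sumr sumr_le0 // => i ci.
  by rewrite toRD pairingDr cz // add0r.
move=> u /g'0[h1 h2 ue].
rewrite toRD pairingDr toR_sum pairing_sumr => /eqP.
rewrite paddr_eq0 ?sumr_ge0 // => /andP[/eqP sum0 /eqP um0].
rewrite gE; split.
  apply/dual_icone_seq => f fE.
  have [_] := edges_shift mS m'S fE ue.
  by rewrite toRD pairingDr um0 addr0.
rewrite /= mRE pairing_suml big1 // => i _.
rewrite pairingZl; have := c0 i; rewrite le_eqVlt => /orP[/eqP<-|ci]; first by rewrite mul0r.
have := psumr_eq0P (fun i _ => h2 i) sum0 => /(_ i ci).
by rewrite toRD pairingDr um0 addr0 pairingC => ->; rewrite mulr0.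
Qed.

End Vertices.
End Fan.

(** * Vertex cones of the Nash polyhedron *)

Section NashFan.
Context {R : realType} {d : nat}.
Implicit Types (h : 'I_d -> 'rV[int]_d) (g V tau sigma : set 'rV[R]_d).

(** Full dimension of the dual cone is recorded by [d] independent lattice points, the form in which
    [simp_unit_shift] uses it. *)
Definition pointed_full_dual V : Prop := exists E,
  [/\ dual_cone V = icone E, strongly_convex (@icone R d E)
    & exists2 h, detr h != 0 & forall i, dual_semigroup V (h i)].

Lemma dual_cone_pointed sigma :
  full_dimensional sigma -> strongly_convex (dual_cone sigma).
Proof.
move=> [B [sB freeB]] v dv dNv; apply: trmx_inj; rewrite trmx0.
have Bv : B *m v^T = 0.
  apply/matrixP => i j; rewrite !ord1 [RHS]mxE.
  have -> : (B *m v^T) i 0 = pairing (row i B) v.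
    by rewrite /pairing -row_mul [RHS]mxE.
  rewrite pairingC; apply/le_anti.
  by rewrite dv // -[X in _ && X]opprK andbT -oppr_ge0 -pairingNl dNv.
have Bu : B \in unitmx by rewrite -row_free_unit.
by rewrite -(mulKmx Bu v^T) Bv mulmx0.
Qed.

Lemma finite_hilbert_basis E : strongly_convex (@icone R d E) ->
  exists Gs, (forall a, hilbert_basis (@icone R d E) a <-> a \in Gs)
    /\ icone E = icone Gs :> set 'rV[R]_d.
Proof.
move=> Epointed; rewrite hilbert_basisE //.
have [s irrs] := @irreducible_finite R d E.
exists [seq a <- s | `[< irreducible_in (@icone R d E) a >]]; split.
  move=> a; rewrite mem_filter; split; last by case/andP => /asboolP.
  by move=> airr; rewrite irrs // andbT; apply/asboolP.
apply/seteqP; split; apply: cone_hullS => _ [e eE <-].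
  have [t tirr ->] := irreducible_gen Epointed (icone_gen eE).
  rewrite toR_sum big_seq; apply: cone_hull_sum => a /tirr airr.
  by apply: icone_gen; rewrite mem_filter irrs // andbT; apply/asboolP.
by move: eE; rewrite /= mem_filter => /andP[/asboolP[]].
Qed.

Lemma finite_sums (P : ('I_d -> 'rV[int]_d) -> Prop) (Gs : seq 'rV[int]_d) :
  exists Ss : seq 'rV[int]_d, forall m, m \in Ss <->
    exists h, [/\ forall i, h i \in Gs, P h & m = \sum_i h i].
Proof.
exists [seq m <- [seq \sum_i nth 0 Gs (f i) | f : {ffun 'I_d -> 'I_(size Gs)}]
  | `[< exists h, [/\ forall i, h i \in Gs, P h & m = \sum_i h i] >]] => m.
rewrite mem_filter; split; first by case/andP => /asboolP.
move=> mh; apply/andP; split; first exact/asboolP.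
have [h [hG _ ->]] := mh; apply/mapP.
have hi i : (index (h i) Gs < size Gs)%N by rewrite index_mem.
exists [ffun i => Ordinal (hi i)]; first by rewrite mem_enum.
by apply: eq_bigr => i _; rewrite ffunE nth_index.
Qed.

Lemma nash_fan_structure sigma :
  rational_polyhedral_cone sigma -> full_dimensional sigma ->
  polyhedral_fan (nash_fan 0 sigma) /\
  exists Max : set (set 'rV[R]_d),
    [/\ Max `<=` nash_fan 0 sigma, Max `<=` pointed_full_dual
      & forall g, nash_fan 0 sigma g -> exists2 V, Max V & g `<=` V].
Proof.
move=> [s sigmaE] sfull.
have [E tauE] : exists E, dual_cone sigma = icone E.
  by rewrite sigmaE; exact: dual_icone.
have := dual_cone_pointed sfull; rewrite tauE => Epointed.
have [Gs [GsE EG]] := finite_hilbert_basis Epointed.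
have [Ss SsE] := finite_sums (fun h => detr h != 0) Gs.
have QE : nash_polyhedron 0 sigma =
    conv_hull [set v | exists2 m, m \in Ss & exists2 w, icone E w & v = toR m + w].
  rewrite /nash_polyhedron tauE; congr conv_hull; apply/seteqP; split => v.
    move=> [h [Gh dn0 [w tw ->]]]; exists (\sum_i h i); last by exists w.
    apply/SsE; exists h; split=> //; first by move=> i; apply/GsE.
    by rewrite detp0E modz0 in dn0.
  move=> [m /SsE[h [hG dn0 ->]] [w tw ->]]; exists h; split.
  - by move=> i; apply/GsE.
  - by rewrite detp0E modz0.
  - by exists w.
rewrite /nash_fan QE; split; first exact: normal_fan_polyhedral EG.
set Q := conv_hull _.
exists [set V | exists2 v, vertex Q v & V = vertex_cone Q v]; split.
- move=> _ [v Qv ->]; exists v => //; exists 0; first exact: dual_cone0.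
  by apply/seteqP; split=> [u ?|u []//]; split=> //=; rewrite pairing0l.
- move=> _ [v Qv ->]; have [m mS vE] := vertex_in_sums EG Qv.
  exists (edges Ss Gs m); rewrite vE (vertex_coneE EG mS) icone_bidual.
  rewrite vE in Qv; split=> //.
    exact: (vertex_edges_pointed EG mS Qv).
  (* The Hilbert basis elements [h i] that sum to the vertex [m] are recession directions, hence
     edges at [m], and their determinant is nonzero. *)
  have /SsE[h [hG dn0 _]] := mS; exists h => // i.
  rewrite /dual_semigroup icone_bidual; apply: icone_gen; exact: edges_gens.
- move=> g [v Qv [u _ ->]]; exists (vertex_cone Q v); first by exists v.
  exact: subIsetl.
Qed.

End NashFan.

(** * Toric varieties *)

Section Semigroup.
Context {R : realType} {d : nat}.
Implicit Types (g : set 'rV[R]_d) (a b : 'rV[int]_d).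

Lemma dual_semigroupP g a :
  dual_semigroup g a <-> forall u, g u -> 0 <= pairing u (toR a).
Proof. by split=> ga u gu; [rewrite pairingC; apply: ga | rewrite pairingC; apply: ga]. Qed.

Lemma dual_semigroup0 g : dual_semigroup g 0.
Proof. by apply/dual_semigroupP => u _; rewrite toR0 pairing0r. Qed.

Lemma dual_semigroupD g a b :
  dual_semigroup g a -> dual_semigroup g b -> dual_semigroup g (a + b).
Proof.
move=> /dual_semigroupP ga /dual_semigroupP gb; apply/dual_semigroupP => u gu.
by rewrite toRD pairingDr addr_ge0 ?ga ?gb.
Qed.

Lemma dual_semigroupMn g a n : dual_semigroup g a -> dual_semigroup g (a *+ n).
Proof.
by move=> ga; elim: n => [|n IH]; [exact: dual_semigroup0 | rewrite mulrS; exact: dual_semigroupD].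
Qed.

Lemma dual_semigroupS g g' : g `<=` g' -> dual_semigroup g' `<=` dual_semigroup g.
Proof. by move=> gg' a /dual_semigroupP ga; apply/dual_semigroupP => u /gg' /ga. Qed.

(** On a generator [f] where [a] vanishes, [b] is nonnegative by hypothesis; elsewhere [a] is an
    integer at least 1, so adding [N] times [a] outweighs [b] once [N] is at least its absolute
    value at [f]. *)
Lemma dual_semigroup_localization F a b : dual_semigroup (@icone R d F) a ->
  (forall u : 'rV[R]_d, icone F u -> pairing u (toR a) = 0 -> 0 <= pairing u (toR b)) ->
  exists N, dual_semigroup (@icone R d F) (b + a *+ N).
Proof.
move=> Fa Fb; exists (\sum_(f <- F) absz (ipair f b))%N.
set N := (\sum_(f <- F) _)%N.
apply/dual_semigroupP => u Fu; rewrite pairingC.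
suff /(_ u Fu) : dual_cone (@icone R d F) (toR (b + a *+ N)) by [].
apply/dual_icone_seq => f fF; rewrite pairingC toRD pairingDr toRMn pairingZr.
have fE : icone F (toR f : 'rV[R]_d) by exact: icone_gen.
have := (dual_semigroupP _ _).1 Fa _ fE; have := Fb _ fE.
rewrite !pairing_toR => fb; rewrite ler0z le_eqVlt => /orP[/eqP fa|fa].
  by rewrite -fa mulr0 addr0; apply: fb; rewrite -fa.
rewrite (@pmulrn _ _ N) -intrM -intrD ler0z.
have : (absz (ipair f b) <= N)%N by rewrite /N (big_rem f) //= leq_addr.
nia.
Qed.

End Semigroup.

(** * Localisation and gluing of charts *)

Section Gluing.
Context {R : realType} {d : nat} {k : fieldType}.
Implicit Types (g : set 'rV[R]_d) (a b : 'rV[int]_d) (x y z : 'rV[int]_d -> k).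

Lemma chart0 g x : chart g x -> x 0 = 1.
Proof. by case. Qed.

Lemma chartD g x a b : chart g x -> dual_semigroup g a -> dual_semigroup g b ->
  x (a + b) = x a * x b.
Proof. by case=> _ + _; apply. Qed.

Lemma chart_out g x a : chart g x -> ~ dual_semigroup g a -> x a = 0.
Proof. by case=> _ _; apply. Qed.

Lemma chartMn g x a n : chart g x -> dual_semigroup g a -> x (a *+ n) = x a ^+ n.
Proof.
move=> gx ga; elim: n => [|n IH]; first by rewrite expr0 (chart0 gx).
by rewrite mulrS exprS (chartD gx) ?IH //; exact: dual_semigroupMn.
Qed.

Lemma chart_unit g x a : chart g x -> dual_semigroup g a ->
  dual_semigroup g (- a) -> x a != 0.
Proof.
move=> gx ga gNa; apply/eqP => xa0; have := chartD gx ga gNa.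
by rewrite subrr (chart0 gx) xa0 mul0r; apply/eqP/oner_neq0.
Qed.

Lemma chart_ext g x y : chart g x -> chart g y ->
  (forall a, dual_semigroup g a -> x a = y a) -> x = y.
Proof.
move=> gx gy xy; apply/funext => a; have [ga|ga] := pselect (dual_semigroup g a).
  exact: xy.
by rewrite (chart_out gx) // (chart_out gy).
Qed.

(** Restriction of a morphism to a smaller semigroup; the value 0 elsewhere is the one that [chart]
    prescribes. *)
Definition restrict_to g y : 'rV[int]_d -> k :=
  fun a => if `[< dual_semigroup g a >] then y a else 0.

Lemma restrict_toE g y a : dual_semigroup g a -> restrict_to g y a = y a.
Proof. by rewrite /restrict_to => /asboolP->. Qed.

Lemma chart_restrict g g' y : g `<=` g' -> chart g y -> chart g' (restrict_to g' y).
Proof.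
move=> gg' gy; have sub := dual_semigroupS gg'; split.
- by rewrite restrict_toE ?(chart0 gy) //; exact: dual_semigroup0.
- move=> a b ga gb; rewrite !restrict_toE //; last exact: dual_semigroupD.
  by apply: (chartD gy); exact: sub.
- by move=> a /asboolPn/negbTE; rewrite /restrict_to => ->.
Qed.

Section Localize.
Variables (g h : set 'rV[R]_d) (a : 'rV[int]_d).
Hypotheses (hg : h `<=` g) (ga : dual_semigroup g a) (hNa : dual_semigroup h (- a)).
Hypothesis loc : forall b, dual_semigroup h b -> exists N, dual_semigroup g (b + a *+ N).

Let sub := dual_semigroupS hg.

Lemma localize_uniq x y : chart h x -> chart h y ->
  (forall b, dual_semigroup g b -> x b = y b) -> x = y.
Proof.
move=> hx hy xy; apply: (chart_ext hx hy) => b hb.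
have [N gbN] := loc hb; have := xy _ gbN.
have haN := dual_semigroupMn N (sub ga).
rewrite (chartD hx) // (chartD hy) // (xy _ (dual_semigroupMn N ga)).
apply: mulIf; rewrite (chartMn _ hy) ?expf_neq0 //; last exact: sub.
exact: (chart_unit hy (sub ga) hNa).
Qed.

(** Universal property of the localisation: by [loc], the semigroup of [h] arises from that of [g]
    by inverting [a], so a morphism extends once its value at [a] is invertible. *)
Lemma localize_ext x : chart g x -> x a != 0 ->
  exists2 y, chart h y & forall b, dual_semigroup g b -> x b = y b.
Proof.
move=> gx xa0.
(* Independence of the chosen exponent makes the quotient well defined and, below,
   multiplicative. *)
have indep b N M : dual_semigroup g (b + a *+ N) -> dual_semigroup g (b + a *+ M) ->
    x (b + a *+ N) / x a ^+ N = x (b + a *+ M) / x a ^+ M.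
  move=> gN gM; apply/eqP; rewrite eqr_div ?expf_neq0 //.
  rewrite -!(chartMn _ gx ga) -!(chartD gx) //; try exact: dual_semigroupMn.
  by rewrite addrAC.
pose N b := if pselect (dual_semigroup h b) is left hb then sval (cid (loc hb)) else 0%N.
have gN b : dual_semigroup h b -> dual_semigroup g (b + a *+ N b).
  by rewrite /N; case: pselect => // hb _; case: cid.
pose y b := if `[< dual_semigroup h b >] then x (b + a *+ N b) / x a ^+ N b else 0.
have yE b n : dual_semigroup h b -> dual_semigroup g (b + a *+ n) ->
    y b = x (b + a *+ n) / x a ^+ n.
  by move=> hb gn; rewrite /y; have /asboolP-> := hb; apply: indep => //; exact: gN.
exists y; last first.
  by move=> b gb; rewrite (yE b 0%N) ?addr0 ?expr0 ?divr1 //; exact: sub.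
split.
- by rewrite (yE 0 0%N) ?addr0 ?expr0 ?divr1 ?(chart0 gx) //; exact: dual_semigroup0.
- move=> b c hb hc; have gbc : dual_semigroup g (b + c + a *+ (N b + N c)).
    by rewrite mulrnDr addrACA; apply: dual_semigroupD; exact: gN.
  rewrite (yE _ _ _ gbc); last exact: dual_semigroupD.
  rewrite (yE _ _ hb (gN _ hb)) (yE _ _ hc (gN _ hc)) mulrnDr addrACA.
  by rewrite (chartD gx (gN _ hb) (gN _ hc)) exprD invfM mulrACA.
- by move=> b /asboolPn/negbTE; rewrite /y => ->.
Qed.

End Localize.

Variable Sigma : set (set 'rV[R]_d).
Hypothesis fan : polyhedral_fan Sigma.

Lemma fan_localization g h a : Sigma g -> dual_semigroup g a ->
  (forall u, g u -> pairing u (toR a) = 0 -> h u) ->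
  forall b, dual_semigroup h b -> exists N, dual_semigroup g (b + a *+ N).
Proof.
move=> Sg ga ah b /dual_semigroupP hb; have [F gE] := fan.1 _ Sg.
rewrite gE; apply: dual_semigroup_localization; rewrite -gE // => u gu ua.
by apply: hb; exact: ah.
Qed.

Local Notation glued := (@glued R d k Sigma).

Lemma glued_refl q : in_atlas Sigma q -> glued q q.
Proof. by move=> Aq; split=> //; exists q.2; rewrite setIid; case: Aq. Qed.

Lemma glued_sym q q' : glued q q' -> glued q' q.
Proof. by move=> [Aq Aq' [y [gy qy q'y]]]; split=> //; exists y; rewrite setIC. Qed.

Lemma overlap_uniq g g' x y : Sigma g -> Sigma g' ->
  chart (g `&` g') x -> chart (g `&` g') y ->
  (forall b, dual_semigroup g' b -> x b = y b) -> x = y.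
Proof.
move=> Sg Sg'; have [a [g'a gNa ag]] := fan.2 _ _ Sg Sg'.
apply: (localize_uniq (@subIsetr _ g g') g'a (dual_semigroupS (@subIsetl _ g g') gNa)).
by apply: fan_localization => // u g'u ua; split=> //; exact: ag.
Qed.

(** Inside the chart of [g2] the two overlaps are the loci where the separating characters [a] and
    [b] do not vanish. [x2] lies in both, so it extends to a point [z] of the triple intersection,
    defined by [a + b]; uniqueness on each overlap identifies the restrictions of [z] with [y12] and
    [y23]. *)
Lemma glued_trans q1 q2 q3 : glued q1 q2 -> glued q2 q3 -> glued q1 q3.
Proof.
case: q1 q2 q3 => [g1 x1] [g2 x2] [g3 x3].
move=> [A1 A2 [y12 /= [c12 y1 y2]]] [_ A3 [y23 /= [c23 y2' y3]]]; split=> //=.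
have [/= S1 C1] := A1; have [/= S2 C2] := A2; have [/= S3 C3] := A3.
have [a [g2a g1a ag1]] := fan.2 _ _ S1 S2.
have [b [g2b g3b bg3]] := fan.2 _ _ S3 S2.
pose h := g1 `&` g2 `&` g3.
have h1 : h `<=` g1 by move=> u [[]].
have h2 : h `<=` g2 by move=> u [[]].
have h3 : h `<=` g3 by move=> u [[]].
have xa : x2 a != 0.
  rewrite y2 // (chart_unit c12) //.
    apply: dual_semigroupS g2a; exact: subIsetr.
  apply: dual_semigroupS g1a; exact: subIsetl.
have xb : x2 b != 0.
  rewrite y2' // (chart_unit c23) //.
    apply: dual_semigroupS g2b; exact: subIsetl.
  apply: dual_semigroupS g3b; exact: subIsetr.
have [|||z cz zx2] := @localize_ext g2 h (a + b) h2 _ _ x2 C2.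
- exact: dual_semigroupD.
- apply: fan_localization; [by [] | exact: dual_semigroupD |] => u g2u /eqP.
  have ua := (dual_semigroupP _ _).1 g2a u g2u.
  have ub := (dual_semigroupP _ _).1 g2b u g2u.
  rewrite toRD pairingDr paddr_eq0 // => /andP[/eqP/(ag1 _ g2u) g1u /eqP/(bg3 _ g2u) g3u].
  by [].
- by rewrite (chartD C2) // mulf_neq0.
have z12 : restrict_to (g1 `&` g2) z = y12.
  apply: (overlap_uniq S1 S2) => //; first by apply: chart_restrict cz; exact: subIsetl.
  move=> c gc; rewrite restrict_toE -?zx2 ?y2 //; apply: dual_semigroupS gc; exact: subIsetr.
have z23 : restrict_to (g2 `&` g3) z = y23.
  rewrite setIC; apply: (overlap_uniq S3 S2) => //.
  - by apply: chart_restrict cz => u [[]].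
  - by rewrite setIC.
  move=> c gc; rewrite restrict_toE -?zx2 ?y2' //; apply: dual_semigroupS gc; exact: subIsetr.
exists (restrict_to (g1 `&` g3) z); split.
- by apply: chart_restrict cz => u [[]].
- move=> c gc; rewrite y1 // -z12 !restrict_toE //; apply: dual_semigroupS gc; exact: subIsetl.
- move=> c gc; rewrite y3 // -z23 !restrict_toE //; apply: dual_semigroupS gc; exact: subIsetr.
Qed.

End Gluing.

(** * Laurent polynomials as functions on a chart *)

Section LaurentPoly.
Context {R : realType} {d : nat} {k : fieldType}.
Implicit Types (g : set 'rV[R]_d) (a b : 'rV[int]_d) (x y z : 'rV[int]_d -> k).
Implicit Types (D : set 'rV[int]_d) (s t : seq (k * 'rV[int]_d)).
Implicit Types (f : ('rV[int]_d -> k) -> k).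

(* A list of pairs (coefficient, exponent) represents a Laurent polynomial. *)
Definition leval s x : k := \sum_(c <- s) c.1 * x c.2.

Definition lmul s t : seq (k * 'rV[int]_d) :=
  [seq (c.1 * e.1, c.2 + e.2) | c <- s, e <- t].

Definition lsupp D s : Prop := forall c, c \in s -> D c.2.

(** Only values on the chart count, since a product of two sums of characters is again such a sum
    only where [x] is multiplicative. *)
Definition regular_on g f : Prop :=
  exists2 s, lsupp (dual_semigroup g) s & forall x, chart g x -> f x = leval s x.

Lemma leval_cat s t x : leval (s ++ t) x = leval s x + leval t x.
Proof. by rewrite /leval big_cat. Qed.

Lemma leval1 c a x : leval [:: (c, a)] x = c * x a.
Proof. by rewrite /leval big_seq1. Qed.

Lemma leval_mul g s t x : chart g x -> lsupp (dual_semigroup g) s ->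
  lsupp (dual_semigroup g) t -> leval (lmul s t) x = leval s x * leval t x.
Proof.
move=> gx gs gt; rewrite /leval /lmul big_allpairs_dep /= big_distrl /=.
rewrite big_seq [RHS]big_seq; apply: eq_bigr => c cs.
rewrite big_distrr /= big_seq [RHS]big_seq; apply: eq_bigr => e et.
by rewrite (chartD gx (gs _ cs) (gt _ et)) mulrACA.
Qed.

Lemma lsupp_mul D D' D'' s t : (forall a b, D a -> D' b -> D'' (a + b)) ->
  lsupp D s -> lsupp D' t -> lsupp D'' (lmul s t).
Proof.
by move=> DD Ds Dt _ /allpairsP[[c e] /= [cs et ->]]; apply: DD; [exact: Ds | exact: Dt].
Qed.

Lemma lsupp_cat D s t : lsupp D s -> lsupp D t -> lsupp D (s ++ t).
Proof. by move=> Ds Dt c; rewrite mem_cat => /orP[/Ds|/Dt]. Qed.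

Lemma lsupp1 D c a : D a -> lsupp D [:: (c, a)].
Proof. by move=> Da e; rewrite inE => /eqP->. Qed.

Lemma regular_char g a : dual_semigroup g a -> regular_on g (fun x => x a).
Proof.
move=> ga; exists [:: (1, a)]; first exact: lsupp1.
by move=> x _; rewrite leval1 mul1r.
Qed.

Lemma regular_cst g c : regular_on g (fun=> c).
Proof.
exists [:: (c, 0)]; first by apply: lsupp1; exact: dual_semigroup0.
by move=> x gx; rewrite leval1 (chart0 gx) mulr1.
Qed.

Lemma regular_add g f f' : regular_on g f -> regular_on g f' ->
  regular_on g (fun x => f x + f' x).
Proof.
move=> [s gs fs] [t gt ft]; exists (s ++ t); first exact: lsupp_cat.
by move=> x gx; rewrite leval_cat fs ?ft.
Qed.

Lemma regular_mul g f f' : regular_on g f -> regular_on g f' ->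
  regular_on g (fun x => f x * f' x).
Proof.
move=> [s gs fs] [t gt ft]; exists (lmul s t).
  by apply: lsupp_mul gs gt => a b; exact: dual_semigroupD.
by move=> x gx; rewrite (leval_mul gx) // fs ?ft.
Qed.

Lemma regular_opp g f : regular_on g f -> regular_on g (fun x => - f x).
Proof.
move=> gf; have [s gs fs] := regular_mul (regular_cst g (-1)) gf.
by exists s => // x gx; rewrite -fs // mulN1r.
Qed.

Lemma regular_sub g f f' : regular_on g f -> regular_on g f' ->
  regular_on g (fun x => f x - f' x).
Proof. by move=> gf gf'; apply: regular_add => //; exact: regular_opp. Qed.

Lemma regular_exp g f n : regular_on g f -> regular_on g (fun x => f x ^+ n).
Proof.
move=> gf; elim: n => [|n IH]; first exact: regular_cst.
have [s gs fs] := regular_mul gf IH.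
by exists s => // x gx; rewrite exprS fs.
Qed.

Lemma regular_sum g I (r : seq I) (P : pred I) (f : I -> _ -> k) :
  (forall i, P i -> regular_on g (f i)) ->
  regular_on g (fun x => \sum_(i <- r | P i) f i x).
Proof.
move=> gf; elim: r => [|i r [s gs fs]].
  by under eq_fun do rewrite big_nil; exact: regular_cst.
under eq_fun do rewrite big_cons; case: (boolP (P i)) => Pi; last by exists s.
by apply: regular_add; [exact: gf | exists s].
Qed.

Lemma chart_poly_regular g f : chart_poly g f -> regular_on g f.
Proof.
move=> [n [a [c [ga ->]]]]; apply: regular_sum => i _.
by apply: regular_mul; [exact: regular_cst | exact: regular_char].
Qed.

Lemma regular_chart_poly g f : regular_on g f ->
  exists2 f', chart_poly g f' & forall x, chart g x -> f x = f' x.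
Proof.
move=> [s gs fs].
exists (fun x => \sum_(i < size s) (nth (0, 0) s i).1 * x (nth (0, 0) s i).2).
  exists (size s), (fun i : 'I__ => (nth (0, 0) s i).2), (fun i : 'I__ => (nth (0, 0) s i).1).
  by split=> // i; apply: gs; exact: mem_nth.
by move=> x gx; rewrite fs // /leval (big_nth (0, 0)) big_mkord.
Qed.

End LaurentPoly.

(** * Points and germs of the glued variety *)

Section Points.
Context {R : realType} {d : nat} {k : fieldType}.
Variable Sigma : set (set 'rV[R]_d).
Hypothesis fan : polyhedral_fan Sigma.
Implicit Types (g : set 'rV[R]_d) (a b : 'rV[int]_d) (x y z : 'rV[int]_d -> k).
Implicit Types (P : toric_point k Sigma) (U : set (toric_point k Sigma)).
Implicit Types (F H : ('rV[int]_d -> k) -> k).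

Local Notation glued := (@glued R d k Sigma).

Lemma coord_atlas g x P : chart_coord g x P -> Sigma g /\ chart g x.
Proof.
by case: P => c cP; rewrite /chart_coord /=; case: cP => q Aq -> [].
Qed.

Lemma coord_glued g x g' x' P :
  chart_coord g x P -> chart_coord g' x' P -> glued (g, x) (g', x').
Proof.
case: P => c cP; rewrite /chart_coord /=; case: cP => q Aq -> qx qx'.
by apply: glued_trans qx' => //; exact: glued_sym.
Qed.

Lemma coord_trans g x g' x' P :
  chart_coord g x P -> glued (g, x) (g', x') -> chart_coord g' x' P.
Proof.
case: P => c cP; rewrite /chart_coord /=; case: cP => q Aq -> qx xx'.
exact: glued_trans xx'.
Qed.

Lemma coord_inj g x x' P : chart_coord g x P -> chart_coord g x' P -> x = x'.
Proof.
move=> gx gx'; have [_ _ [y [gy /= xy x'y]]] := coord_glued gx gx'.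
apply: chart_ext (coord_atlas gx).2 (coord_atlas gx').2 _ => a ga.
by rewrite xy // x'y.
Qed.

Lemma coord_eq g x P P' : chart_coord g x P -> chart_coord g x P' -> P = P'.
Proof.
move=> xP xP'; apply: eq_sig_hprop => [c|]; first exact: Prop_irrelevance.
case: P P' xP xP' => c cP [c' cP'] /=; rewrite /chart_coord /=.
case: cP => q _ ->; case: cP' => q' _ -> qx qx'.
apply/funext => r; apply/propext; split=> [qr|q'r].
  by apply: glued_trans qr => //; apply: glued_trans (glued_sym qx).
by apply: glued_trans q'r => //; apply: glued_trans (glued_sym qx').
Qed.

Lemma coord_exists g x : Sigma g -> chart g x -> exists P, chart_coord g x P.
Proof.
move=> Sg gx; have Aq : in_atlas Sigma (g, x) by [].
exists (exist _ (glued (g, x)) (ex_intro2 _ _ (g, x) Aq erefl)).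
exact: glued_refl.
Qed.

Lemma point_coord P : exists g x, chart_coord g x P.
Proof.
case: P => c cP; case: (cP) => -[g x] Aq cE; exists g, x.
by rewrite /chart_coord /= cE; exact: glued_refl.
Qed.

Lemma coord_widen g g' x P : g `<=` g' -> Sigma g' -> chart_coord g x P ->
  chart_coord g' (restrict_to g' x) P.
Proof.
move=> gg' Sg' gx; have [Sg cx] := coord_atlas gx; apply: (coord_trans gx).
split=> //; first by split=> //=; apply: chart_restrict cx.
exists x; rewrite /= (setIidl gg'); split=> // a ga.
exact: restrict_toE.
Qed.

(* A is a character whose nonvanishing defines the overlap of the two charts in
   U_g', and F' is F with its denominators cleared. *)
Lemma overlap g g' : Sigma g -> Sigma g' -> exists A,
  [/\ regular_on g' A,
      forall x', chart g' x' -> (A x' != 0 <-> exists x, glued (g, x) (g', x'))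
    & forall F, regular_on g F -> exists N F', regular_on g' F' /\
        forall x x', glued (g, x) (g', x') -> F' x' = A x' ^+ N * F x].
Proof.
move=> Sg Sg'; have [a [g'a gNa ag]] := fan.2 _ _ Sg Sg'.
have Il := @subIsetl _ g g'; have Ir := @subIsetr _ g g'.
have loc : forall b, dual_semigroup (g `&` g') b ->
    exists N, dual_semigroup g' (b + a *+ N).
  by apply: (fan_localization fan Sg' g'a) => u g'u ua; split=> //; exact: ag.
exists (fun x' => x' a); split.
- exact: regular_char.
- move=> x' g'x'; split=> [xa|[x [_ _ [y [gy _ /= x'y]]]]]; last first.
    rewrite x'y // (chart_unit gy) //; first exact: dual_semigroupS Ir _ g'a.
    exact: dual_semigroupS Il _ gNa.
  have [y gy x'y] := localize_ext Ir g'a loc g'x' xa.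
  exists (restrict_to g y); split=> //.
    by split=> //=; apply: chart_restrict gy.
  by exists y; split=> //= b gb; rewrite restrict_toE.
move=> F [s gs Fs].
have [N gN] : exists N, forall c, c \in s -> dual_semigroup g' (c.2 + a *+ N).
  elim: s gs {Fs} => [|c s IH] gs; first by exists 0%N.
  have [N gN] := IH (fun e es => gs e (mem_behead (s := c :: s) es)).
  have [M gM] := loc _ (dual_semigroupS Il (gs c (mem_head _ _))).
  exists (N + M)%N => e; rewrite inE => /orP[/eqP->|/gN es]; last first.
    by rewrite mulrnDr addrA; apply: dual_semigroupD => //; exact: dual_semigroupMn.
  by rewrite addnC mulrnDr addrA; apply: dual_semigroupD => //; exact: dual_semigroupMn.
exists N, (leval [seq (c.1, c.2 + a *+ N) | c <- s]); split.
  exists [seq (c.1, c.2 + a *+ N) | c <- s] => // _ /mapP[c cs ->] /=.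
  exact: gN.
move=> x x' [[_ /= gx] [_ /= g'x'] [y [gy /= xy x'y]]].
rewrite Fs // /leval big_map mulr_sumr big_seq [RHS]big_seq.
apply: eq_bigr => c cs /=; rewrite mulrCA; congr (_ * _).
have ga : dual_semigroup (g `&` g') a by exact: dual_semigroupS g'a.
have gc : dual_semigroup (g `&` g') c.2 by apply: dual_semigroupS (gs _ cs).
by rewrite (x'y _ (gN _ cs)) (chartD gy gc (dual_semigroupMn N ga)) (chartMn _ gy ga)
  -(x'y _ g'a) -(xy _ (gs _ cs)) mulrC.
Qed.

Definition basic_open g F : set (toric_point k Sigma) :=
  [set P | exists2 x, chart_coord g x P & F x != 0].

Lemma preimage_sub g U : chart_preimage g U `<=` chart g.
Proof. by move=> x [P _ /coord_atlas[]]. Qed.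

(** Seen from [g'], the set is the locus where [A * F'] does not vanish; the factor [A] confines it
    to the overlap. *)
Lemma basic_open_open g F : Sigma g -> regular_on g F -> toric_open (basic_open g F).
Proof.
move=> Sg gF g' Sg'; split; first exact: preimage_sub.
have [A [g'A glA trA]] := overlap Sg Sg'.
have [N [F' [g'F' F'E]]] := trA F gF.
have [f pf fE] := regular_chart_poly (regular_mul g'A g'F').
move=> x' [P [x xP Fx] x'P]; exists f.
have gl := coord_glued xP x'P; have cx' := (coord_atlas x'P).2.
have Ax' : A x' != 0 by apply/glA => //; exists x.
split=> //; first by rewrite -fE // (F'E _ _ gl) !mulf_neq0 // expf_neq0.
move=> y' g'y'; rewrite -fE // mulf_eq0 negb_or => /andP[/glA-/(_ g'y')[y gly] F'y].
have [P' y'P'] := coord_exists Sg' g'y'; exists P' => //.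
exists y; first exact: coord_trans y'P' (glued_sym gly).
by move: F'y; rewrite (F'E _ _ gly) mulf_eq0 negb_or => /andP[].
Qed.

Lemma open_local U P g x : toric_open U -> U P -> chart_coord g x P ->
  exists F, [/\ regular_on g F, F x != 0 & basic_open g F `<=` U].
Proof.
move=> Uo UP xP; have [Sg gx] := coord_atlas xP.
have [_ /(_ x)] := Uo g Sg => /(_ (ex_intro2 _ _ P UP xP))[F [pF Fx FU]].
exists F; split=> //; first exact: chart_poly_regular.
move=> P' [y yP' Fy]; have [P'' UP'' yP''] := FU _ (coord_atlas yP').2 Fy.
by rewrite (coord_eq yP' yP'').
Qed.

(** A point has at most one coordinate in the chart of [g], so the choice is immaterial; 0 is a
    filler off the chart. *)
Definition fraction g F H : toric_point k Sigma -> k := fun P =>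
  if pselect (exists x, chart_coord g x P) is left e
  then F (projT1 (cid e)) / H (projT1 (cid e)) else 0.

Lemma fractionE g F H x P : chart_coord g x P -> fraction g F H P = F x / H x.
Proof.
move=> xP; rewrite /fraction; case: pselect => [e|[]]; last by exists x.
by case: (cid e) => y yP /=; rewrite (coord_inj xP yP).
Qed.

Lemma fraction_regular g F H : Sigma g -> regular_on g F -> regular_on g H ->
  toric_regular (basic_open g H) (fraction g F H).
Proof.
move=> Sg gF gH; split; first exact: basic_open_open.
move=> g' Sg'; have [A [g'A glA trA]] := overlap Sg Sg'.
have [N [F' [g'F' F'E]]] := trA F gF; have [M [H' [g'H' H'E]]] := trA H gH.
exists (fun x' => if pselect (exists P, chart_coord g' x' P) is left e
  then fraction g F H (projT1 (cid e)) else 0); last first.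
  move=> x P _ xP; case: pselect => [e|[]]; last by exists P.
  by case: (cid e) => P' xP' /=; rewrite (coord_eq xP xP').
(* On the overlap [F' = A^N F] and [H' = A^M H]; the powers of [A] are attached crosswise so that
   they cancel in the quotient. *)
have [f pf fE] := regular_chart_poly (regular_mul g'F' (regular_exp M g'A)).
have [h ph hE] := regular_chart_poly (regular_mul g'H' (regular_exp N g'A)).
have key P x' : basic_open g H P -> chart_coord g' x' P ->
    h x' != 0 /\ fraction g F H P = f x' / h x'.
  move=> [x xP Hx] x'P; have gl := coord_glued xP x'P.
  have g'x' := (coord_atlas x'P).2.
  have Ax' : A x' != 0 by apply/glA => //; exists x.
  rewrite -fE // -hE // (F'E _ _ gl) (H'E _ _ gl) (fractionE _ _ xP).
  have AN : A x' ^+ N != 0 by rewrite expf_neq0.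
  have AM : A x' ^+ M != 0 by rewrite expf_neq0.
  split; first by rewrite !mulf_neq0.
  by field; rewrite AN AM Hx.
move=> x' [P UP x'P]; exists f, h; have [hx' _] := key _ _ UP x'P.
split=> // y [P' UP' yP'] _; case: pselect => [e|[]]; last by exists P'.
case: (cid e) => P'' yP'' /=; have <- := coord_eq yP' yP''.
by have [] := key _ _ UP' yP'.
Qed.

Definition germ_fraction g x phi F H : Prop :=
  [/\ regular_on g F, regular_on g H, H x != 0
    & forall x' P', chart_coord g x' P' -> H x' != 0 -> phi P' = F x' / H x'].

Lemma regular_local U phi P g x : toric_regular U phi -> U P ->
  chart_coord g x P -> exists F H, germ_fraction g x phi F H.
Proof.
move=> [Uo Ur] UP xP; have [Sg gx] := coord_atlas xP.
have [K [gK Kx KU]] := open_local Uo UP xP.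
have [psi psir phiE] := Ur g Sg.
have [f [h [pf ph hx fhE]]] := psir x (ex_intro2 _ _ P UP xP).
(* The factor [K] shrinks the nonvanishing locus of the denominator into [U]. *)
exists (fun x => f x * K x), (fun x => h x * K x); split.
- by apply: regular_mul => //; exact: chart_poly_regular.
- by apply: regular_mul => //; exact: chart_poly_regular.
- by rewrite mulf_neq0.
move=> x' P' x'P'; rewrite mulf_eq0 negb_or => /andP[hx' Kx'].
have UP' : U P' by apply: KU; exists x'.
rewrite (phiE x') // (fhE x') //; last by exists P'.
by rewrite invfM mulrACA divff // mulr1.
Qed.

Local Notation X := (toric_variety k Sigma).

Lemma max_ideal_local (P : X) (phi : X -> k) g x : max_ideal P phi ->
  chart_coord g x P -> exists F H, germ_fraction g x phi F H /\ F x = 0.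
Proof.
move=> [[U [_ UP Ur]] phi0] xP.
have [F [H FH]] := regular_local Ur UP xP; exists F, H; split=> //.
have [_ _ Hx /(_ x P xP Hx)] := FH; rewrite phi0 => /esym/eqP.
by rewrite mulf_eq0 invr_eq0 (negbTE Hx) orbF => /eqP.
Qed.

Lemma fraction_max_ideal (P : X) g x F H : chart_coord g x P -> regular_on g F ->
  regular_on g H -> H x != 0 -> F x = 0 -> max_ideal P (fraction g F H : X -> k).
Proof.
move=> xP gF gH Hx Fx; have [Sg gx] := coord_atlas xP.
split; last by rewrite (fractionE _ _ xP) Fx mul0r.
exists (basic_open g H); split; [exact: basic_open_open | by exists x |].
exact: fraction_regular.
Qed.

Definition square_poly g x T : Prop := exists n (F G : 'I_n -> ('rV[int]_d -> k) -> k),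
  [/\ forall i, regular_on g (F i) /\ F i x = 0,
      forall i, regular_on g (G i) /\ G i x = 0
    & forall x', chart g x' -> T x' = \sum_i F i x' * G i x'].

Lemma square_poly0 g x : square_poly g x (fun=> 0).
Proof.
exists 0%N, (fun _ _ => 0), (fun _ _ => 0); split; try by case.
by move=> x' _; rewrite big_ord0.
Qed.

Lemma square_polyD g x T T' : square_poly g x T -> square_poly g x T' ->
  square_poly g x (fun x' => T x' + T' x').
Proof.
move=> [n [F [G [FP GP TE]]]] [n' [F' [G' [FP' GP' TE']]]].
exists (n + n')%N,
  (fun i : 'I_(n + n') => match fintype.split i with inl j => F j | inr j => F' j end),
  (fun i : 'I_(n + n') => match fintype.split i with inl j => G j | inr j => G' j end).
split; try by move=> i; case: (fintype.split i).
move=> x' gx'; rewrite TE // TE' // big_split_ord /=.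
congr (_ + _); apply: eq_bigr => i _.
- by rewrite -[lshift _ i]/(unsplit (inl i)) unsplitK.
- by rewrite -[rshift _ i]/(unsplit (inr i)) unsplitK.
Qed.

Lemma square_polyM g x T F : regular_on g F -> square_poly g x T ->
  square_poly g x (fun x' => F x' * T x').
Proof.
move=> gF [n [F1 [G [FP GP TE]]]].
exists n, (fun i x' => F x' * F1 i x'), G; split=> //.
  move=> i; have [gF1 ->] := FP i; rewrite mulr0; split=> //.
  exact: regular_mul.
by move=> x' gx'; rewrite TE // mulr_sumr; apply: eq_bigr => i _; rewrite mulrA.
Qed.

(** Membership in the square of the maximal ideal of the local ring, with denominators cleared:
    [H phi] lies in the square of the maximal ideal of the coordinate ring, for some [H] invertible
    at [x]. *)
Definition square_local g x (phi : X -> k) : Prop :=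
  exists H T, [/\ regular_on g H, square_poly g x T, H x != 0
    & forall x' P', chart_coord g x' P' -> H x' != 0 -> phi P' * H x' = T x'].

Lemma square_local_comb I (r : seq I) g x (l : I -> k) (phi : I -> X -> k) :
  (forall i, square_local g x (phi i)) ->
  square_local g x (fun P => \sum_(i <- r) l i * phi i P).
Proof.
move=> sphi; elim: r => [|i r [H [T [gH sT Hx HT]]]].
  exists (fun=> 1), (fun=> 0).
  split; [exact: regular_cst | exact: square_poly0 | exact: oner_neq0 |].
  by move=> x' P' _ _; rewrite big_nil mul0r.
have [H' [T' [gH' sT' Hx' HT']]] := sphi i.
exists (fun x => H x * H' x), (fun x => (l i * H x) * T' x + H' x * T x); split.
- exact: regular_mul.
- apply: square_polyD; apply: square_polyM => //.
  by apply: regular_mul => //; exact: regular_cst.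
- by rewrite mulf_neq0.
move=> x' P' x'P'; rewrite mulf_eq0 negb_or => /andP[Hx'0 Hx'0'].
by rewrite big_cons -(HT _ _ x'P') // -(HT' _ _ x'P') //; ring.
Qed.

Lemma square_local_max_ideal_sq (P : X) (phi : X -> k) g x :
  chart_coord g x P -> square_local g x phi -> max_ideal_sq P phi.
Proof.
move=> xP [H [T [gH [n [F [G [FP GP TE]]]] Hx HT]]].
have [Sg gx] := coord_atlas xP.
exists n, (fun i => fraction g (F i) H), (fun i => fraction g (G i) (fun=> 1)); split.
- by move=> i; have [gF F0] := FP i; apply: (fraction_max_ideal xP).
- move=> i; have [gG G0] := GP i; apply: (fraction_max_ideal xP) => //.
    exact: regular_cst.
  exact: oner_neq0.
exists (basic_open g H); split; [exact: basic_open_open | by exists x |].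
move=> P' [x' x'P' Hx']; apply: (mulIf Hx'); rewrite (HT _ _ x'P') // TE; last first.
  by have [] := coord_atlas x'P'.
rewrite mulr_suml; apply: eq_bigr => i _.
by rewrite !(fractionE _ _ x'P') divr1 mulrAC divfK.
Qed.

Lemma max_ideal_sq_local (P : X) (phi : X -> k) g x : max_ideal_sq P phi ->
  chart_coord g x P -> square_local g x phi.
Proof.
move=> [n [a [b [aP bP [U [Uo UP phiE]]]]]] xP.
have [K [gK Kx KU]] := open_local Uo UP xP.
suff [H [T [gH sT Hx HT]]] : exists H T,
    [/\ regular_on g H, square_poly g x T, H x != 0 & forall x' P',
      chart_coord g x' P' -> H x' != 0 -> (\sum_i a i P' * b i P') * H x' = T x'].
  exists (fun x => K x * H x), (fun x => K x * T x); split.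
  - exact: regular_mul.
  - exact: square_polyM.
  - by rewrite mulf_neq0.
  move=> x' P' x'P'; rewrite mulf_eq0 negb_or => /andP[Kx' Hx'].
  have UP' : U P' by apply: KU; exists x'.
  by rewrite phiE // mulrCA (HT _ _ x'P').
elim: n a b aP bP {phiE} => [|n IH] a b aP bP.
  exists (fun=> 1), (fun=> 0).
  split; [exact: regular_cst | exact: square_poly0 | exact: oner_neq0 |].
  by move=> x' P' _ _; rewrite big_ord0 mul0r.
have [H [T [gH sT Hx HT]]] := IH (fun i => a (lift ord0 i)) (fun i => b (lift ord0 i))
  (fun i => aP _) (fun i => bP _).
have [F1 [H1 [[gF1 gH1 H1x a0E] F1x]]] := max_ideal_local (aP ord0) xP.
have [F2 [H2 [[gF2 gH2 H2x b0E] F2x]]] := max_ideal_local (bP ord0) xP.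
exists (fun x => H1 x * H2 x * H x), (fun x => H x * (F1 x * F2 x) + (H1 x * H2 x) * T x).
split.
- by apply: regular_mul => //; exact: regular_mul.
- apply: square_polyD; apply: square_polyM => //; last exact: regular_mul.
  exists 1%N, (fun=> F1), (fun=> F2); split=> // x' _.
  by rewrite big_ord1.
- by rewrite !mulf_neq0.
move=> x' P' x'P'; rewrite !mulf_eq0 !negb_or => /andP[/andP[H1x' H2x'] Hx'].
rewrite big_ord_recl mulrDl -(HT _ _ x'P') // (a0E _ _ x'P') // (b0E _ _ x'P') //.
by field; rewrite H1x' H2x'.
Qed.

End Points.

(** * Tangent vectors *)

Section Torus.
Context {R : realType} {d : nat} {k : closedFieldType}.
Implicit Types (g : set 'rV[R]_d) (a b : 'rV[int]_d) (x y z xi : 'rV[int]_d -> k).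

Lemma nonroot (p : {poly k}) : p != 0 -> exists s, p.[s] != 0.
Proof. by move=> /closed_nonrootP[s ps]; exists s. Qed.

Definition torus_point g (t : 'I_d -> k) : 'rV[int]_d -> k :=
  restrict_to g (fun a => \prod_j t j ^ a 0 j).

Lemma torus_chart g t : (forall j, t j != 0) -> chart g (torus_point g t).
Proof.
move=> t0; rewrite /torus_point; split.
- rewrite restrict_toE; last exact: dual_semigroup0.
  by rewrite big1 // => j _; rewrite mxE expr0z.
- move=> a b ga gb; rewrite !restrict_toE //; last exact: dual_semigroupD.
  by rewrite -big_split; apply: eq_bigr => j _; rewrite mxE expfzDr.
- by move=> a /asboolPn/negbTE; rewrite /restrict_to => ->.
Qed.

Lemma torus_neq0 g t a : (forall j, t j != 0) -> dual_semigroup g a ->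
  torus_point g t a != 0.
Proof.
move=> t0 ga; rewrite /torus_point restrict_toE //.
by apply/prodf_neq0 => j _; rewrite expfz_neq0.
Qed.

(** An algebraically closed field contains a nonroot of [X (X^|n| - 1)], in every characteristic. *)
Lemma expz_neq1 (n : int) : n != 0 -> exists2 s : k, s != 0 & s ^ n != 1.
Proof.
move=> n0.
suff [s s0 sn] : exists2 s : k, s != 0 & s ^+ absz n != 1.
  exists s => //; case: n n0 sn => [n|n] n0 //=.
  by rewrite NegzE -invr_expz invr_eq1.
have [|s] := @nonroot ('X * ('X^(absz n) - 1%:P)).
  by rewrite mulf_neq0 ?polyX_eq0 // monic_neq0 // monicXnsubC // absz_gt0.
rewrite !hornerE mulf_eq0 negb_or subr_eq0 => /andP[s0 sn].
by exists s.
Qed.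

Lemma chart_separates g a b : dual_semigroup g a -> dual_semigroup g b -> a <> b ->
  exists2 z : _ -> k, chart g z & z a != z b.
Proof.
move=> ga gb ab.
have [j abj] : exists j, a 0 j != b 0 j.
  apply: contrapT => /forallNP H; apply: ab; apply/rowP => j.
  by apply/eqP; apply: contrapT => /negP/H.
have [|s s0 sn] := @expz_neq1 (a 0 j - b 0 j); first by rewrite subr_eq0.
pose t i := if i == j then s else 1.
have t0 i : t i != 0 by rewrite /t; case: ifP => // _; exact: oner_neq0.
exists (torus_point g t); first exact: torus_chart.
have tE c : dual_semigroup g c -> torus_point g t c = s ^ c 0 j.
  move=> gc; rewrite /torus_point restrict_toE // (bigD1 j) //= /t eqxx.
  by rewrite big1 ?mulr1 // => i /negbTE->; rewrite exp1rz.
rewrite !tE //; apply: contra sn => /eqP sab.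
by rewrite expfzDr // -invr_expz sab divff ?expfz_neq0.
Qed.

Lemma chartM g x z : chart g x -> chart g z -> chart g (fun a => x a * z a).
Proof.
move=> gx gz; split.
- by rewrite (chart0 gx) (chart0 gz) mulr1.
- by move=> a b ga gb; rewrite (chartD gx) // (chartD gz) // mulrACA.
- by move=> a ga; rewrite (chart_out gx) // mul0r.
Qed.

(** Dedekind's argument: translating the relation by a torus point [z] and subtracting [z a] times
    the original removes the term of [a]; if [z] separates [a] from [b], the coefficient of [b] must
    vanish. *)
Lemma characters_independent g (E : seq 'rV[int]_d) (q : 'rV[int]_d -> k) :
  uniq E -> (forall a, a \in E -> dual_semigroup g a) ->
  (forall x, chart g x -> \sum_(a <- E) q a * x a = 0) -> forall a, a \in E -> q a = 0.
Proof.
elim: E q => [|a E IH] q //= /andP[aE uE] gE q0.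
have ga : dual_semigroup g a by apply: gE; rewrite mem_head.
have gE' b : b \in E -> dual_semigroup g b by move=> bE; apply: gE; rewrite inE bE orbT.
have qE b : b \in E -> q b = 0.
  move=> bE.
  have [|z gz zab] := chart_separates ga (gE' b bE).
    by move=> ab; rewrite ab bE in aE.
  have zero x : chart g x -> \sum_(e <- E) (q e * (z e - z a)) * x e = 0.
    move=> gx; have := q0 _ (chartM gx gz); have := q0 _ gx; rewrite !big_cons.
    have -> : \sum_(e <- E) q e * (z e - z a) * x e =
        \sum_(e <- E) q e * (x e * z e) - z a * \sum_(e <- E) q e * x e.
      by rewrite mulr_sumr -sumrB; apply: eq_bigr => e _; ring.
    move=> /eqP; rewrite addrC addr_eq0 => /eqP->.
    by rewrite addrC => /eqP; rewrite addr_eq0 => /eqP->; ring.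
  have /(_ b bE)/eqP := IH (fun e => q e * (z e - z a)) uE gE' zero.
  by rewrite mulf_eq0 subr_eq0 eq_sym [z b == _]eq_sym (negbTE zab) orbF eq_sym => /eqP.
move=> b; rewrite inE => /orP[/eqP->|/qE //].
have := q0 _ (@torus_chart g (fun=> 1) (fun=> oner_neq0 _)).
rewrite big_cons [X in _ + X]big_seq big1 ?addr0 => [/eqP|c cE]; last by rewrite qE ?mul0r.
by rewrite mulf_eq0 (negbTE (torus_neq0 _ ga)) ?orbF => [/eqP|j]; last exact: oner_neq0.
Qed.

Lemma leval_collect (s : seq (k * 'rV[int]_d)) (f : 'rV[int]_d -> k) :
  leval s f = \sum_(a <- undup [seq c.2 | c <- s]) (\sum_(c <- s | c.2 == a) c.1) * f a.
Proof.
under [RHS]eq_bigr do rewrite big_distrl /= big_mkcond.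
rewrite exchange_big /= /leval big_seq [RHS]big_seq; apply: eq_bigr => c cs.
have cE : c.2 \in undup [seq c.2 | c <- s] by rewrite mem_undup; apply/mapP; exists c.
rewrite (bigD1_seq _ cE (undup_uniq _)) /= eqxx big1 ?addr0 // => a.
by rewrite eq_sym => /negbTE->.
Qed.

(** Here [xi] is an arbitrary function: a polynomial that vanishes on the chart is formally zero, so
    it may be evaluated at tangent vectors. *)
Lemma leval_eq0 g (s : seq (k * 'rV[int]_d)) : lsupp (dual_semigroup g) s ->
  (forall x, chart g x -> leval s x = 0) -> forall xi, leval s xi = 0.
Proof.
move=> gs s0 xi; rewrite leval_collect big_seq big1 // => a aE.
rewrite (@characters_independent g _ (fun a => \sum_(c <- s | c.2 == a) c.1) _ _ _ _ aE) ?mul0r //.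
- exact: undup_uniq.
- by move=> b; rewrite mem_undup => /mapP[c cs ->]; exact: gs.
- by move=> x gx; rewrite -leval_collect s0.
Qed.

(** A tangent vector at [x] given by its values on characters; [leval s xi] is then the derivative
    of the polynomial [s] along it. *)
Definition point_derivation g x xi : Prop :=
  forall a b, dual_semigroup g a -> dual_semigroup g b ->
    xi (a + b) = x a * xi b + xi a * x b.

Lemma derivation_mul g x xi s t : point_derivation g x xi ->
  lsupp (dual_semigroup g) s -> lsupp (dual_semigroup g) t ->
  leval (lmul s t) xi = leval s x * leval t xi + leval s xi * leval t x.
Proof.
move=> dxi gs gt; rewrite /leval /lmul big_allpairs_dep /= !big_distrl /= -big_split /=.
rewrite big_seq [RHS]big_seq; apply: eq_bigr => c cs.
rewrite !big_distrr /= -big_split /= big_seq [RHS]big_seq; apply: eq_bigr => e et.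
by rewrite dxi; [ring | exact: gs | exact: gt].
Qed.

End Torus.

(** * Cotangent space at a torus-fixed point *)

Section Cotangent.
Context {R : realType} {d : nat} {k : closedFieldType}.
Variable Sigma : set (set 'rV[R]_d).
Hypothesis fan : polyhedral_fan Sigma.
Implicit Types (g : set 'rV[R]_d) (a b : 'rV[int]_d) (x y z xi : 'rV[int]_d -> k).
Local Notation X := (toric_variety k Sigma).

Lemma derivation_square g x xi T : point_derivation g x xi -> chart g x ->
  square_poly g x T -> exists s, [/\ lsupp (dual_semigroup g) s,
    forall x', chart g x' -> T x' = leval s x' & leval s xi = 0 /\ leval s x = 0].
Proof.
move=> dxi gx [n]; elim: n T => [|n IH] T [F [G [FP GP TE]]].
  exists [::]; split=> // [x' gx'|]; last by rewrite /leval !big_nil.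
  by rewrite TE // big_ord0 /leval big_nil.
have [|s [gs sE [sxi sx]]] := IH (fun x' => \sum_(i < n) F (lift ord0 i) x' * G (lift ord0 i) x').
  by exists (fun i => F (lift ord0 i)), (fun i => G (lift ord0 i)).
have [[u gu Fu] F0] := FP ord0; have [[v gv Gv] G0] := GP ord0.
exists (lmul u v ++ s); split.
- apply: lsupp_cat => //; apply: lsupp_mul gu gv => a b; exact: dual_semigroupD.
- by move=> x' gx'; rewrite TE // big_ord_recl leval_cat (leval_mul gx') // sE // Fu // Gv.
- rewrite !leval_cat sxi sx (leval_mul gx) // (derivation_mul dxi) //.
  by rewrite -(Fu _ gx) -(Gv _ gx) F0 G0 !(mul0r, mulr0, addr0).
Qed.

(** The relation [H (H s - T) = 0] holds on the whole chart, the outer factor covering the zeros of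
    [H], and is therefore formal. Differentiated at [x], where [s] vanishes and [T] is in the
    square, it leaves [H(x)^2] times the derivative of [s]. *)
Lemma derivation_square_local (P : X) (phi : X -> k) g x xi s :
  point_derivation g x xi -> chart_coord g x P -> square_local g x phi ->
  lsupp (dual_semigroup g) s -> leval s x = 0 ->
  (forall x' P', chart_coord g x' P' -> phi P' = leval s x') -> leval s xi = 0.
Proof.
move=> dxi xP [H [T [[h gh Hh] sT Hx HT]]] gs sx phiE; have [Sg gx] := coord_atlas xP.
have [t [gt Tt [txi tx]]] := derivation_square dxi gx sT.
have gD a b := @dual_semigroupD R d g a b.
have ghs : lsupp (dual_semigroup g) (lmul h s) by exact: lsupp_mul gD gh gs.
have ghhs : lsupp (dual_semigroup g) (lmul h (lmul h s)) by exact: lsupp_mul gD gh ghs.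
have ght : lsupp (dual_semigroup g) (lmul h t) by exact: lsupp_mul gD gh gt.
have gm1 : lsupp (dual_semigroup g) [:: (-1 : k, 0)] by apply: lsupp1; exact: dual_semigroup0.
have gmht : lsupp (dual_semigroup g) (lmul [:: (-1 : k, 0)] (lmul h t)).
  exact: lsupp_mul gD gm1 ght.
have := @leval_eq0 R d k g (lmul h (lmul h s) ++ lmul [:: (-1, 0)] (lmul h t)) _ _ xi.
rewrite leval_cat !(derivation_mul dxi) // txi (leval_mul gx) // tx sx !(mulr0, addr0).
rewrite (leval_mul gx) // tx !(mulr0, addr0).
move=> /(_ (lsupp_cat ghhs gmht)) hs; apply/eqP.
have Hx' : leval h x != 0 by rewrite -Hh.
rewrite -(mulrI_eq0 _ (mulfI Hx')) -(mulrI_eq0 _ (mulfI Hx')); apply/eqP/hs.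
move=> x' gx'; rewrite leval_cat !(leval_mul gx') // leval1 (chart0 gx') -Hh // -Tt //.
have [P' x'P'] := coord_exists Sg gx'.
have [->|Hx'0] := eqVneq (H x') 0; first by rewrite !mul0r mulr0 addr0.
by rewrite -(HT _ _ x'P' Hx'0) (phiE _ _ x'P'); ring.
Qed.

(* P is the torus-fixed point of the chart of V; for an irreducible a, the map
   sending a to 1 and the rest of the semigroup to 0 is a tangent vector at P. *)
Lemma cotangent_dim_irreducibles V : Sigma V ->
  (forall a b, dual_semigroup V a -> dual_semigroup V b -> a + b = 0 -> a = 0) ->
  exists P : X, forall n (s : seq 'rV[int]_d), cotangent_dim P n -> uniq s ->
    (forall a, a \in s -> irreducible_in (dual_cone V) a) -> (size s <= n)%N.
Proof.
move=> SV Vpointed.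
pose x0 : 'rV[int]_d -> k := fun a => (a == 0)%:R.
have Vx0 : chart V x0.
  split.
  - by rewrite /x0 eqxx.
  - move=> a b Va Vb; rewrite /x0 -natrM mulnb; congr (nat_of_bool _)%:R.
    apply/eqP/andP => [ab0|[/eqP-> /eqP->]]; last by rewrite addr0.
    have a0 := Vpointed _ _ Va Vb ab0; move: ab0.
    by rewrite a0 add0r => ->.
  - move=> a Va; rewrite /x0; case: eqP => // a0; case: Va; rewrite a0.
    exact: dual_semigroup0.
have [P x0P] := coord_exists SV Vx0.
exists (P : X) => n s [t [tP tB]] us sirr; rewrite leqNgt; apply/negP => ns.
pose a (j : 'I_(size s)) := nth 0 s j.
have aS j : a j \in s by exact: mem_nth.
have airr j := sirr _ (aS j).
have Va j : dual_semigroup V (a j) by have [] := airr j.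
have an0 j : a j <> 0 by have [] := airr j.
pose chi j : X -> k := fraction V (fun x => x (a j)) (fun=> 1).
have chiP j : @max_ideal k X P (chi j).
  apply: (fraction_max_ideal fan x0P);
    [exact: regular_char | exact: regular_cst | exact: oner_neq0 |].
  by rewrite /x0; case: eqP => // /an0.
have /choice[c cP] : forall j, exists c : 'rV[k]_n,
    @max_ideal_sq k X P (fun y : X => chi j y - \sum_i c 0 i * t i y).
  by move=> j; have [c [cj _]] := tB _ (chiP j); exists c.
pose C := \matrix_j c j.
(* More than [n] rows of length [n] are dependent. A relation [l] puts the combination of the
   [chi j] in the square, and the tangent vector dual to [a j0] then forces the coefficient [l 0 j0]
   to vanish. *)
have : kermx C != 0.
  rewrite kermx_eq0; apply/negP => freeC.
  have : (\rank C <= n)%N by exact: rank_leq_col.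
  by rewrite (eqP freeC) leqNgt ns.
move=> /rowV0Pn[l /sub_kermxP lC /eqP ln0]; apply: ln0; apply/rowP => j0; rewrite mxE.
pose sl := [seq (l 0 j, a j) | j : 'I_(size s)].
have slE x : leval sl x = \sum_j l 0 j * x (a j).
  by rewrite /leval /sl big_map big_enum.
pose xi : 'rV[int]_d -> k := fun b => (b == a j0)%:R.
have dxi : point_derivation V x0 xi.
  move=> b e Vb Ve; rewrite /xi /x0.
  have [b0|bn0] := eqVneq b 0.
    by rewrite b0 add0r mul1r eq_sym; case: (0 =P a j0) => [/esym/an0 //|_]; rewrite mul0r addr0.
  have [e0|en0] := eqVneq e 0; first by rewrite e0 addr0 mul0r mulr1 add0r.
  rewrite mul0r mulr0 addr0; case: eqP => // beE; have [_ _ /(_ b e Vb Ve (esym beE))] := airr j0.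
  by case=> /eqP; rewrite ?(negbTE bn0) ?(negbTE en0).
have := derivation_square_local
  (phi := fun y : X => \sum_j l 0 j * (chi j y - \sum_i c j 0 i * t i y))
  (s := sl) dxi x0P.
have -> : leval sl xi = l 0 j0.
  rewrite slE (bigD1 j0) //= /xi eqxx mulr1 big1 ?addr0 // => j jj0.
  by rewrite nth_uniq // -val_eqE /= in jj0 *; rewrite (negbTE jj0) mulr0.
apply.
- by apply: square_local_comb => // j; apply: (max_ideal_sq_local fan (cP j)).
- by move=> _ /mapP[j _ ->]; exact: Va.
- by rewrite slE big1 // => j _; rewrite /x0; case: eqP (an0 j) => // _ _; rewrite mulr0.
move=> x' P' x'P'; rewrite slE.
under eq_bigr do rewrite mulrBr.
rewrite sumrB [X in _ - X](_ : _ = 0) ?subr0.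
  by apply: eq_bigr => j _; rewrite /chi (fractionE fan _ _ x'P') divr1.
under eq_bigr do rewrite mulr_sumr.
rewrite exchange_big /= big1 // => i _.
under eq_bigr do rewrite mulrA.
rewrite -mulr_suml.
have := congr1 (fun M : 'rV[k]_n => M 0 i) lC; rewrite !mxE => lCi.
rewrite [X in X * _](_ : _ = 0) ?mul0r // -[RHS]lCi.
by apply: eq_bigr => j _; rewrite !mxE.
Qed.

End Cotangent.

(** * Dimension *)

Section Dimension.
Context {R : realType} {d : nat} {k : fieldType}.
Variable Sigma : set (set 'rV[R]_d).
Hypothesis fan : polyhedral_fan Sigma.
Implicit Types (a b : 'rV[int]_d) (x y z : 'rV[int]_d -> k).
Implicit Types (f : ('rV[int]_d -> k) -> k).
Local Notation X := (toric_variety k Sigma).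
Implicit Types (Z : set X).
Local Notation basic_open := (@basic_open R d k Sigma).

Section Chart.
Variable g : set 'rV[R]_d.
Hypothesis Sg : Sigma g.

Definition vanishes Z f : Prop :=
  forall x (P : toric_point k Sigma), Z P -> chart_coord g x P -> f x = 0.

(** The ideal of an irreducible closed set is prime: [Z] is covered by the complements of the two
    nonvanishing loci. *)
Lemma irreducible_vanishes_mul Z f f' : irreducible_closed Z ->
  regular_on g f -> regular_on g f' -> vanishes Z (fun x => f x * f' x) ->
  vanishes Z f \/ vanishes Z f'.
Proof.
move=> [_ _ Zirr] gf gf' Zff'.
have closedC h : regular_on g h -> @is_closed k X (~` basic_open g h).
  by move=> gh; rewrite /is_closed setCK; exact: basic_open_open.
have vanC h : Z `<=` ~` basic_open g h -> vanishes Z h.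
  move=> Zh x P ZP xP; apply/eqP; apply: contrapT => /negP hx.
  by apply: (Zh P ZP); exists x.
have [|/vanC|/vanC] := Zirr _ _ (closedC f gf) (closedC f' gf'); try by [left|right].
move=> P ZP; apply: contrapT => /not_orP[/contrapT[x xP fx] /contrapT[x' x'P f'x']].
have := Zff' x P ZP xP; rewrite (coord_inj fan xP x'P) in fx *.
by apply/eqP; rewrite mulf_neq0.
Qed.

(** The function must live on the chart [g], so a point of [Z'] outside [Z] is needed inside this
    chart. Otherwise [Z'] would be covered by [Z] and the complement of the chart, and it is
    contained in neither, as [P] lies in the chart. *)
Lemma chain_function Z Z' P x : irreducible_closed Z' -> is_closed Z ->
  Z `<` Z' -> Z P -> chart_coord g x P ->
  exists2 f, regular_on g f & vanishes Z f /\ ~ vanishes Z' f.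
Proof.
move=> [_ _ Z'irr] Zcl [ZZ' Z'Z] ZP xP.
have Ucl : @is_closed k X (~` basic_open g (fun=> 1)).
  by rewrite /is_closed setCK; apply: basic_open_open => //; exact: regular_cst.
have [P' Z'P' [UP' ZP']] : exists2 P', Z' P' & basic_open g (fun=> 1) P' /\ ~ Z P'.
  apply: contrapT => H; have [|//|] := Z'irr _ _ Zcl Ucl.
    move=> P' Z'P'; have [ZP'|ZP'] := pselect (Z P'); first by left.
    by right => UP'; apply: H; exists P'.
  by move=> /(_ P (ZZ' P ZP)); apply; exists x => //; exact: oner_neq0.
have [x' x'P' _] := UP'.
have [f [gf fx' fZ]] := open_local fan Zcl ZP' x'P'.
exists f => //; split; last by move=> /(_ x' P' Z'P' x'P'); exact/eqP.
move=> y Q ZQ yQ; apply/eqP; apply: contrapT => /negP fy.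
by apply: (fZ Q); [exists y | ].
Qed.

(* As f vanishes on Z, so does S 0, which is then identically 0; divide the
   series by f on the irreducible Z' and repeat. *)
Lemma vanishes_series Z Z' f N (S : nat -> ('rV[int]_d -> k) -> k) :
  irreducible_closed Z' -> Z `<=` Z' -> regular_on g f ->
  vanishes Z f -> ~ vanishes Z' f -> (forall j, regular_on g (S j)) ->
  (forall j, (j < N)%N -> vanishes Z (S j) -> forall x, chart g x -> S j x = 0) ->
  vanishes Z' (fun x => \sum_(j < N) S j x * f x ^+ j) ->
  forall j, (j < N)%N -> vanishes Z (S j).
Proof.
move=> Z'irr ZZ' gf Zf Z'f; elim: N S => // N IH S gS S0 vS.
have vS0 : vanishes Z (S 0%N).
  move=> x P ZP xP; have := vS x P (ZZ' P ZP) xP.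
  rewrite big_ord_recl expr0 mulr1 big1 ?addr0 // => i _.
  by rewrite (Zf x P ZP xP) expr0n mulr0.
have {}S00 := S0 0%N isT vS0.
have [//||Z'f'|vS'] := @irreducible_vanishes_mul Z' f
    (fun x => \sum_(j < N) S j.+1 x * f x ^+ j) Z'irr gf.
- by apply: regular_sum => i _; apply: regular_mul => //; exact: regular_exp.
- move=> x P ZP xP; have := vS x P ZP xP.
  rewrite big_ord_recl S00 ?mul0r ?add0r; last by have [] := coord_atlas xP.
  move=> sum0; rewrite -[RHS]sum0 mulr_sumr; apply: eq_bigr => i _.
  by rewrite /= /bump /= add1n exprS mulrCA.
- by case: Z'f.
move=> [//|j]; rewrite ltnS => jN; apply: (IH (fun j => S j.+1)) => // i iN.
exact: S0.
Qed.

Lemma sum_nat_mul (V : nmodType) N M (G : nat -> V) :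
  \sum_(e < N * M) G e = \sum_(j < N) \sum_(r < M) G (j * M + r)%N.
Proof.
elim: N => [|N IH]; first by rewrite mul0n !big_ord0.
by rewrite mulSnr big_split_ord /= IH big_ord_recr.
Qed.

Section Monomials.
Variables (F : nat -> ('rV[int]_d -> k) -> k) (N : nat).
Hypothesis N0 : (0 < N)%N.

(* The exponents of F 0, ..., F (n - 1) in the monomial are the base-N digits of e. *)
Fixpoint mono n (e : nat) x : k :=
  if n is n'.+1 then mono n' (e %% N ^ n') x * F n' x ^+ (e %/ N ^ n') else 1.

Hypothesis gF : forall i, regular_on g (F i).

Lemma regular_mono n e : regular_on g (mono n e).
Proof.
elim: n e => [|n IH] e /=; first exact: regular_cst.
by apply: regular_mul => //; exact: regular_exp.
Qed.

(** Grouping by powers of the last function gives a series whose coefficients [S j] involve only the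
    earlier ones. By induction such a coefficient vanishes on [Z n] only if all its scalars are 0,
    which is what [vanishes_series] requires. *)
Lemma mono_independent n (Z : nat -> set X) P x : Z 0%N P -> chart_coord g x P ->
  (forall i, (i <= n)%N -> irreducible_closed (Z i)) ->
  (forall i, (i < n)%N -> Z i `<` Z i.+1) ->
  (forall i, (i < n)%N -> vanishes (Z i) (F i) /\ ~ vanishes (Z i.+1) (F i)) ->
  forall q : nat -> k, vanishes (Z n) (fun x => \sum_(e < N ^ n) q e * mono n e x) ->
  forall e, (e < N ^ n)%N -> q e = 0.
Proof.
move=> ZP xP; elim: n => [|n IH] Zirr Zlt ZF q vq e.
  rewrite expn0 ltnS leqn0 => /eqP->; have := vq x P ZP xP.
  by rewrite expn0 big_ord1 mulr1.
have {}IH := IH (fun i ile => Zirr i (leqW ile)) (fun i ilt => Zlt i (leqW ilt))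
  (fun i ilt => ZF i (leqW ilt)).
rewrite expnS => eN.
have M0 : (0 < N ^ n)%N by rewrite expn_gt0 N0.
pose S j x := \sum_(r < N ^ n) q (j * N ^ n + r)%N * mono n r x.
have [vFn nvFn] := ZF n (ltnSn n).
have gS j : regular_on g (S j).
  by apply: regular_sum => r _; apply: regular_mul; [exact: regular_cst | exact: regular_mono].
have vS : vanishes (Z n.+1) (fun x => \sum_(j < N) S j x * F n x ^+ j).
  move=> y Q ZQ yQ; have /= vqy := vq y Q ZQ yQ; rewrite -[RHS]vqy.
  rewrite expnS (sum_nat_mul N (N ^ n)
    (fun e => q e * (mono n (e %% N ^ n) y * F n y ^+ (e %/ N ^ n)))).
  apply: eq_bigr => j _; rewrite /S mulr_suml; apply: eq_bigr => r _ /=.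
  by rewrite modnMDl modn_small // divnMDl // divn_small // addn0 mulrA.
have Svan j : (j < N)%N -> vanishes (Z n) (S j) -> forall x, chart g x -> S j x = 0.
  move=> jN vSj y gy; rewrite /S big1 // => r _.
  by rewrite (IH (fun r => q (j * N ^ n + r)%N) vSj) ?mul0r.
have := vanishes_series (Zirr _ (leqnn _)) (proj1 (Zlt n (ltnSn n))) (gF n) vFn nvFn gS Svan vS.
move=> /(_ (e %/ N ^ n)%N) vSj; rewrite (divn_eq e (N ^ n)).
apply: (IH (fun r => q (e %/ N ^ n * N ^ n + r)%N)); last by rewrite ltn_pmod.
by apply: vSj; rewrite ltn_divLR.
Qed.

Definition char_bounded B f : Prop := exists2 s,
  lsupp [set a | dual_semigroup g a /\ forall j, `|a 0 j| <= B%:Z] s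
  & forall x, chart g x -> f x = leval s x.

Lemma char_bounded1 B : char_bounded B (fun=> 1).
Proof.
exists [:: (1, 0)]; last by move=> x gx; rewrite leval1 (chart0 gx) mulr1.
by apply: lsupp1; split=> [|j]; [exact: dual_semigroup0 | rewrite mxE].
Qed.

Lemma char_bounded_mul B B' f f' : char_bounded B f -> char_bounded B' f' ->
  char_bounded (B + B') (fun x => f x * f' x).
Proof.
move=> [s gs fs] [t gt ft]; exists (lmul s t).
  apply: lsupp_mul gs gt => a b [ga aB] [gb bB]; split; first exact: dual_semigroupD.
  by move=> j; rewrite mxE; apply: le_trans (ler_normD _ _) _; rewrite PoszD lerD.
move=> x gx; rewrite (leval_mul gx) ?fs ?ft //.
  by move=> c /gs[].
by move=> c /gt[].
Qed.

Lemma char_boundedW B B' f : (B <= B')%N -> char_bounded B f -> char_bounded B' f.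
Proof.
move=> BB' [s gs fs]; exists s => // c /gs[ga aB]; split=> // j.
by apply: le_trans (aB j) _; rewrite lez_nat.
Qed.

Lemma char_bounded_exp B f n : char_bounded B f ->
  char_bounded (n * B) (fun x => f x ^+ n).
Proof.
move=> gf; elim: n => [|n IH]; first exact: char_bounded1.
have [s gs fs] := char_bounded_mul gf IH; exists s; first by rewrite mulSn.
by move=> x gx; rewrite exprS fs.
Qed.

Lemma char_bounded_mono B n e : (forall i, (i < n)%N -> char_bounded B (F i)) ->
  (e < N ^ n)%N -> char_bounded (n * (N * B)) (mono n e).
Proof.
elim: n e => [|n IH] e gB eN; first exact: char_bounded1.
have M0 : (0 < N ^ n)%N by rewrite expn_gt0 N0.
rewrite mulSn addnC; apply: char_bounded_mul.
  by apply: IH; [move=> i ilt; apply: gB; exact: leqW | rewrite ltn_pmod].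
apply: (char_boundedW _ (char_bounded_exp _ (gB n (ltnSn n)))).
by rewrite leq_mul2r ltnW ?orbT // ltn_divLR // -expnS.
Qed.

End Monomials.

Lemma regular_char_bounded f : regular_on g f -> exists B, char_bounded B f.
Proof.
move=> [s gs fs]; exists (\sum_(c <- s) \sum_j absz (c.2 0%R j))%N; exists s => // c cs.
split=> [|j]; first exact: gs.
rewrite -abszE lez_nat (big_rem c) //= (bigD1 j) //= -addnA leq_addr //.
Qed.

Lemma char_bounded_box B f : char_bounded B f ->
  exists m : {ffun 'I_d -> 'I_(B.*2.+1)} -> k,
    forall x, chart g x -> f x = \sum_t m t * x (box t).
Proof.
move=> [s gs fs].
suff [m mE] : exists m : {ffun 'I_d -> 'I_(B.*2.+1)} -> k,
    forall x, leval s x = \sum_t m t * x (box t).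
  by exists m => x gx; rewrite fs.
elim: s gs {fs} => [|c s IH] gs.
  by exists (fun=> 0) => x; rewrite /leval big_nil big1 // => t _; rewrite mul0r.
have [m mE] := IH (fun e es => gs e (mem_behead (s := c :: s) es)).
have [_ cB] := gs c (mem_head _ _); have [t0 ct0] := boxP cB.
exists (fun t => (if t == t0 then c.1 else 0) + m t) => x.
under eq_bigr do rewrite mulrDl.
rewrite big_split /= -mE (bigD1 t0) //= eqxx big1 => [|t /negbTE->]; last by rewrite mul0r.
by rewrite addr0 /leval big_cons ct0.
Qed.

End Chart.

Lemma chain_length (P : X) n : chain_at P n -> (n <= d)%N.
Proof.
move=> [Z [ZP Zirr Zlt]]; rewrite leqNgt; apply/negP => dn.
have [g [x xP]] := point_coord P; have [Sg gx] := coord_atlas xP.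
have ZiP i : (i <= d.+1)%N -> Z i P.
  elim: i => // i IH ilt; have [Zii _] := Zlt i (leq_trans ilt dn).
  by apply: Zii; apply: IH; exact: ltnW.
have /choice[F FP] : forall i, exists f, regular_on g f /\
    ((i < d.+1)%N -> vanishes g (Z i) f /\ ~ vanishes g (Z i.+1) f).
  move=> i; have [id|id] := ltnP i d.+1; last by exists (fun=> 1); split => //; exact: regular_cst.
  have [Zcl _ _] := Zirr i (ltnW (leq_trans id dn)).
  have [f gf vf] := chain_function Sg (Zirr i.+1 (leq_trans id dn)) Zcl
    (Zlt i (leq_trans id dn)) (ZiP i (ltnW id)) xP.
  by exists f.
have gF i := (FP i).1.
have [B FB] : exists B, forall i, (i < d.+1)%N -> char_bounded g B (F i).
  elim: d.+1 => [|m [B FB]]; first by exists 0%N.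
  have [B' FB'] := regular_char_bounded (gF m); exists (B + B')%N => i.
  rewrite ltnS leq_eqVlt => /orP[/eqP->|im]; first exact: char_boundedW (leq_addl _ _) FB'.
  exact: char_boundedW (leq_addr _ _) (FB i im).
(* The monomials have exponents bounded by [B' = (d + 1) N B], and [2 B' + 1 <= c N]. So they
   involve at most [c^d N^d] characters, fewer than the [N^(d + 1)] monomials because [c^d < N]. *)
pose c := (d.+1 * B).*2.+1; pose N := (c ^ d).+1.
pose B' := (d.+1 * (N * B))%N.
have small : (#|{ffun 'I_d -> 'I_(B'.*2.+1)}| < N ^ d.+1)%N.
  rewrite card_ffun !card_ord expnS.
  apply: (@leq_ltn_trans ((c * N) ^ d)).
    have expS m p e : (m <= p)%N -> (m ^ e <= p ^ e)%N.
      by move=> mp; elim: e => // e IHe; rewrite !expnS leq_mul.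
    apply: expS; rewrite /B' /c -!mul2n; have : (0 < N)%N by []; nia.
  by rewrite expnMn ltn_pmul2r ?expn_gt0.
have /fin_all_exists[m mE] : forall e : 'I_(N ^ d.+1), exists m : {ffun 'I_d -> 'I_(B'.*2.+1)} -> k,
    forall x, chart g x -> mono F N d.+1 e x = \sum_t m t * x (box t).
  by move=> e; apply: char_bounded_box; apply: char_bounded_mono.
(* Row [e] lists the coefficients of a monomial in the characters; a vector in the left kernel is an
   algebraic relation, excluded by [mono_independent]. *)
pose A := \matrix_(e < N ^ d.+1, i < #|{ffun 'I_d -> 'I_(B'.*2.+1)}|) m e (enum_val i).
have : kermx A != 0.
  rewrite kermx_eq0; apply/negP => /eqP freeA.
  by have := rank_leq_col A; rewrite freeA leqNgt small.
move=> /rowV0Pn[q /sub_kermxP qA /eqP]; apply; apply/rowP => e; rewrite mxE.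
pose q' (i : nat) := if insub i is Some j then q 0 j else 0.
have q'E (j : 'I_(N ^ d.+1)) : q' j = q 0 j by rewrite /q' valK.
rewrite -q'E.
apply: (@mono_independent g Sg F N _ gF d.+1 Z P x) => //.
- by move=> i ile; apply: Zirr; exact: leq_trans ile dn.
- by move=> i ilt; apply: Zlt; exact: leq_trans ilt dn.
- by move=> i ilt; apply: (FP i).2.
move=> y Q _ yQ; have [_ gy] := coord_atlas yQ.
under eq_bigr do rewrite q'E mE // mulr_sumr.
rewrite exchange_big /= big1 // => t _.
under eq_bigr do rewrite mulrA.
rewrite -mulr_suml.
have := congr1 (fun M : 'rV[k]__ => M 0 (enum_rank t)) qA; rewrite !mxE.
rewrite (eq_bigr (fun j => q 0 j * m j t)) => [->|j _]; first by rewrite mul0r.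
by rewrite mxE enum_rankK.
Qed.

End Dimension.

(** * Nonsingular toric varieties *)

Section FreeChart.
Context {R : realType} {d : nat} {k : closedFieldType}.
Implicit Types (a b : 'rV[int]_d) (x y z xi : 'rV[int]_d -> k) (w : 'I_d -> k).

(** The rows of [B] form a lattice basis and [a *m B'] lists the coordinates of [a] in it; in these
    coordinates the semigroup is that of vectors with nonnegative entries, and the chart is affine
    space. *)
Definition free_semigroup (V : set 'rV[R]_d) : Prop := exists B B' : 'M[int]_d,
  B *m B' = 1%:M /\ forall a, dual_semigroup V a <-> forall i, 0 <= (a *m B') 0 i.

Variables (V : set 'rV[R]_d) (B B' : 'M[int]_d).
Hypothesis BB' : B *m B' = 1%:M.
Hypothesis VE : forall a, dual_semigroup V a <-> forall i, 0 <= (a *m B') 0 i.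

Let coo a i : nat := absz ((a *m B') 0 i).

Lemma coord_nat a i : dual_semigroup V a -> (coo a i)%:Z = (a *m B') 0 i.
Proof. by move=> /VE/(_ i); rewrite /coo; lia. Qed.

Lemma cooD a b i : dual_semigroup V a -> dual_semigroup V b ->
  coo (a + b) i = (coo a i + coo b i)%N.
Proof.
move=> Va Vb; apply/eqP; rewrite -eqz_nat PoszD !coord_nat //; last exact: dual_semigroupD.
by rewrite mulmxDl mxE.
Qed.

Lemma coo0 i : coo 0 i = 0%N.
Proof. by rewrite /coo mul0mx mxE. Qed.

Lemma row_coord i j : (row i B *m B') 0 j = (i == j)%:R.
Proof. by rewrite -row_mul BB' !mxE. Qed.

Lemma coo_row i j : coo (row i B) j = (i == j).
Proof. by rewrite /coo row_coord; case: eqP. Qed.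

Lemma row_semigroup i : dual_semigroup V (row i B).
Proof. by apply/VE => j; rewrite row_coord; case: eqP. Qed.

Definition affine_point w : 'rV[int]_d -> k :=
  restrict_to V (fun a => \prod_i w i ^+ coo a i).

Lemma affine_pointE w a : dual_semigroup V a ->
  affine_point w a = \prod_i w i ^+ coo a i.
Proof. exact: restrict_toE. Qed.

Lemma affine_chart w : chart V (affine_point w).
Proof.
split.
- rewrite affine_pointE; last exact: dual_semigroup0.
  by rewrite big1 // => i _; rewrite coo0 expr0.
- move=> a b Va Vb; rewrite !affine_pointE //; last exact: dual_semigroupD.
  by rewrite -big_split; apply: eq_bigr => i _; rewrite cooD // exprD.
- by move=> a /asboolPn/negbTE; rewrite /affine_point /restrict_to => ->.
Qed.

Lemma affine_point_row w i : affine_point w (row i B) = w i.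
Proof.
rewrite affine_pointE; last exact: row_semigroup.
rewrite (bigD1 i) //= coo_row eqxx expr1 big1 ?mulr1 // => j.
by rewrite coo_row eq_sym => /negbTE->; rewrite expr0.
Qed.

Lemma chart_prod x I (r : seq I) (b : I -> 'rV[int]_d) (n : I -> nat) :
  chart V x -> (forall i, dual_semigroup V (b i)) ->
  dual_semigroup V (\sum_(i <- r) b i *+ n i) /\
  x (\sum_(i <- r) b i *+ n i) = \prod_(i <- r) x (b i) ^+ n i.
Proof.
move=> Vx Vb; elim: r => [|i r [IH1 IH2]].
  by rewrite !big_nil (chart0 Vx); split=> //; exact: dual_semigroup0.
have Vbi := dual_semigroupMn (n i) (Vb i).
rewrite !big_cons; split; first exact: dual_semigroupD.
by rewrite (chartD Vx) // IH2 (chartMn _ Vx).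
Qed.

Lemma chart_affine x : chart V x -> x = affine_point (fun i => x (row i B)).
Proof.
move=> Vx; apply: (chart_ext Vx (affine_chart _)) => a Va.
have [_ xE] := chart_prod (index_enum 'I_d) (coo a) Vx row_semigroup.
rewrite affine_pointE // -xE; congr x.
rewrite -[LHS]mulmx1 -(mulmx1C BB') mulmxA mulmx_sum_row.
by apply: eq_bigr => i _; rewrite -coord_nat // -natz scaler_nat.
Qed.

(** On the line from [w] (at [s = 0]) to [w'] (at [s = 1]) a regular function is a polynomial in one
    variable, with finitely many zeros unless it is 0. *)
Lemma regular_line F w w' : regular_on V F -> exists p : {poly k}, forall s,
  F (affine_point (fun i => w i + s * (w' i - w i))) = p.[s].
Proof.
move=> [u Vu Fu].
exists (\sum_(c <- u) c.1 *: \prod_i ((w i)%:P + (w' i - w i) *: 'X) ^+ coo c.2 i) => s.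
rewrite Fu; last exact: affine_chart.
rewrite /leval horner_sum big_seq [RHS]big_seq; apply: eq_bigr => c cu.
rewrite hornerZ horner_prod affine_pointE; last exact: Vu.
congr (_ * _); apply: eq_bigr => i _.
by rewrite horner_exp !hornerE; congr (_ ^+ _); ring.
Qed.

Variable Sigma : set (set 'rV[R]_d).
Hypothesis fan : polyhedral_fan Sigma.
Hypothesis SV : Sigma V.
Local Notation X := (toric_variety k Sigma).
Local Notation basic_open := (@basic_open R d k Sigma V).

Section Point.
Variables (x : 'rV[int]_d -> k) (P : X).
Hypothesis xP : chart_coord V x P.

Let Vx : chart V x := (coord_atlas xP).2.
Let cc i y : k := y (row i B) - x (row i B).

Let Vcc i : regular_on V (cc i).
Proof. by apply: regular_sub; [apply: regular_char; exact: row_semigroup | exact: regular_cst]. Qed.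

Let ccx i : cc i x = 0.
Proof. by rewrite /cc subrr. Qed.

(** First-order Taylor expansion at [x], with remainder in the square of the maximal ideal. *)
Definition linearizable (F : ('rV[int]_d -> k) -> k) : Prop :=
  regular_on V F /\ exists (c : 'I_d -> k) T, square_poly V x T /\
    forall y, chart V y -> F y = F x + \sum_i c i * cc i y + T y.

Lemma linearizable_cst c : linearizable (fun=> c).
Proof.
split; first exact: regular_cst.
exists (fun=> 0), (fun=> 0); split; first exact: square_poly0.
by move=> y _; rewrite big1 ?addr0 // => i _; rewrite mul0r.
Qed.

Lemma linearizable_coord i : linearizable (fun y => y (row i B)).
Proof.
split; first by apply: regular_char; exact: row_semigroup.
exists (fun j => (j == i)%:R), (fun=> 0); split; first exact: square_poly0.
move=> y _; rewrite (bigD1 i) //= eqxx mul1r big1 ?addr0 => [|j /negbTE->].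
  by rewrite /cc addrC subrK.
by rewrite mul0r.
Qed.

Lemma linearizable_add F G : linearizable F -> linearizable G ->
  linearizable (fun y => F y + G y).
Proof.
move=> [VF [c [T [sT FE]]]] [VG [c' [T' [sT' GE]]]].
split; first exact: regular_add.
exists (fun i => c i + c' i), (fun y => T y + T' y); split; first exact: square_polyD.
move=> y Vy; rewrite FE // GE //; under [in RHS]eq_bigr do rewrite mulrDl.
by rewrite big_split /=; ring.
Qed.

Lemma square_poly_mul F G : regular_on V F -> regular_on V G -> F x = 0 -> G x = 0 ->
  square_poly V x (fun y => F y * G y).
Proof.
move=> VF VG F0 G0; exists 1%N, (fun=> F), (fun=> G); split=> // y _.
by rewrite big_ord1.
Qed.

Lemma linearizable_mul F G : linearizable F -> linearizable G ->
  linearizable (fun y => F y * G y).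
Proof.
move=> [VF [c [T [sT FE]]]] [VG [c' [T' [sT' GE]]]].
split; first exact: regular_mul.
exists (fun i => F x * c' i + G x * c i),
  (fun y => (F y - F x) * (G y - G x) + (F x * T' y + G x * T y)); split.
  apply: square_polyD.
    by apply: square_poly_mul; rewrite ?subrr //; apply: regular_sub => //; exact: regular_cst.
  by apply: square_polyD; apply: square_polyM => //; exact: regular_cst.
move=> y Vy.
have -> : \sum_i (F x * c' i + G x * c i) * cc i y =
    F x * (\sum_i c' i * cc i y) + G x * (\sum_i c i * cc i y).
  by rewrite !mulr_sumr -big_split; apply: eq_bigr => i _; rewrite mulrDl !mulrA.
have := FE y Vy; have := GE y Vy.
move: (\sum_i _) (\sum_i _) (F y) (G y) (F x) (G x) (T y) (T' y) => p q Fy Gy Fx Gx Ty Ty' -> ->.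
by ring.
Qed.

Lemma linearizable_regular F : regular_on V F -> linearizable F.
Proof.
move=> VF; split=> //; have [u Vu Fu] := VF.
suff [_ [c [T [sT uE]]]] : linearizable (leval u).
  by exists c, T; split=> // y Vy; rewrite !Fu //; exact: uE.
rewrite /leval; elim: u Vu {Fu} => [|e u IH] Vu.
  rewrite (_ : (fun _ => _) = fun=> 0); first exact: linearizable_cst.
  by apply/funext => y; rewrite big_nil.
rewrite (_ : (fun _ => _) = fun y => e.1 * y e.2 + leval u y); last first.
  by apply/funext => y; rewrite big_cons.
apply: linearizable_add; last by apply: IH => c cu; apply: Vu; rewrite inE cu orbT.
apply: linearizable_mul; first exact: linearizable_cst.
have Ve : dual_semigroup V e.2 by apply: Vu; rewrite mem_head.
suff [_ [c [T [sT pE]]]] : linearizable (fun y => \prod_i y (row i B) ^+ coo e.2 i).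
  split; first exact: regular_char.
  have yE y : chart V y -> y e.2 = \prod_i y (row i B) ^+ coo e.2 i.
    by move=> Vy; rewrite {1}(chart_affine Vy) affine_pointE.
  by exists c, T; split=> // y Vy; rewrite !yE // pE.
elim: (index_enum _) => [|i r IHr].
  rewrite (_ : (fun _ => _) = fun=> 1); first exact: linearizable_cst.
  by apply/funext => y; rewrite big_nil.
rewrite (_ : (fun _ => _) =
    fun y => y (row i B) ^+ coo e.2 i * \prod_(j <- r) y (row j B) ^+ coo e.2 j); last first.
  by apply/funext => y; rewrite big_cons.
apply: linearizable_mul IHr; elim: (coo e.2 i) => [|n IHn].
  exact: linearizable_cst.
rewrite (_ : (fun _ => _) = fun y => y (row i B) * y (row i B) ^+ n); last first.
  by apply/funext => y; rewrite exprS.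
by apply: linearizable_mul IHn; exact: linearizable_coord.
Qed.

(** The partial derivative at [x] of the character [a] in the coordinate [i]. When the exponent is
    0, the truncated predecessor is harmless because the leading factor is 0. *)
Definition partial i a : k := (coo a i)%:R * x (row i B) ^+ (coo a i).-1 *
  \prod_(j | j != i) x (row j B) ^+ coo a j.

Lemma partial_derivation i : point_derivation V x (partial i).
Proof.
move=> a b Va Vb; rewrite /partial.
have xE c : dual_semigroup V c ->
    x c = x (row i B) ^+ coo c i * \prod_(j | j != i) x (row j B) ^+ coo c j.
  by move=> Vc; rewrite {1}(chart_affine Vx) affine_pointE // (bigD1 i).
rewrite (xE a Va) (xE b Vb).
have -> : \prod_(j | j != i) x (row j B) ^+ coo (a + b) j =
    \prod_(j | j != i) x (row j B) ^+ coo a j * \prod_(j | j != i) x (row j B) ^+ coo b j.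
  by rewrite -big_split; apply: eq_bigr => j _; rewrite cooD // exprD.
rewrite cooD //; move: (\prod_(j | _) _) (\prod_(j | _) _) (x _) => p q t.
case: (coo a i) (coo b i) => [|n] [|m]; rewrite ?addn0 ?add0n ?addSn ?addnS /=.
- by rewrite expr0; ring.
- by rewrite expr0; ring.
- by rewrite expr0; ring.
- by rewrite !exprS !exprD -!natr1 natrD; ring.
Qed.

Lemma partial_row i j : partial i (row j B) = (j == i)%:R.
Proof.
rewrite /partial coo_row; have [->|ji] := eqVneq j i; last by rewrite mul0r mul0r.
rewrite expr0 !mul1r big1 // => l; rewrite coo_row eq_sym => /negbTE->.
exact: expr0.
Qed.

(** The Taylor expansion shows that the coordinate differences span; the partial derivatives, which
    vanish on the square, show that they are independent. *)
Lemma free_cotangent_dim : cotangent_dim P d.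
Proof.
pose t i : X -> k := fraction V (cc i) (fun=> 1).
have tE i y (Q : toric_point k Sigma) : chart_coord V y Q -> t i Q = cc i y.
  by move=> yQ; rewrite /t (fractionE fan _ _ yQ) divr1.
exists t; split.
  move=> i; apply: (fraction_max_ideal fan xP) => //; first exact: regular_cst.
  exact: oner_neq0.
move=> f fP; have [F [H [[VF VH Hx fE] F0]]] := max_ideal_local fan fP xP.
have [_ [c [T [sT FE]]]] := linearizable_regular VF.
(* As [F] vanishes at [x], the linear part of [F / H] is that of [F] divided by the constant
   [H x]. *)
pose c0 : 'rV[k]_d := \row_i (c i / H x).
have sq : square_local V x (fun Q : X => f Q - \sum_i c0 0 i * t i Q).
  (* Multiplication by [H] leaves [T] and the error of replacing [H y] by [H x] in the linear part,
     a product of two functions that vanish at [x]. *)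
  exists H, (fun y => T y + (1 - H y / H x) * \sum_i c i * cc i y); split=> //.
    apply: square_polyD => //; apply: square_poly_mul.
    - apply: regular_sub; first exact: regular_cst.
      by apply: regular_mul => //; exact: regular_cst.
    - by apply: regular_sum => i _; apply: regular_mul => //; exact: regular_cst.
    - by rewrite divff // subrr.
    - by rewrite big1 // => i _; rewrite ccx mulr0.
  move=> y Q yQ Hy; rewrite mulrBl (fE _ _ yQ) // divfK // (FE _ (coord_atlas yQ).2) F0 add0r.
  have -> : \sum_i c0 0 i * t i Q = (\sum_i c i * cc i y) / H x.
    by rewrite mulr_suml; apply: eq_bigr => i _; rewrite mxE (tE _ _ _ yQ) mulrAC.
  by move: (\sum_i _) => s; ring.
exists c0; split; first exact: (square_local_max_ideal_sq fan xP).
move=> c1 /(max_ideal_sq_local fan)/(_ xP) sq1.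
pose l i := c1 0 i - c0 0 i.
(* The polynomial of the difference of the two linear parts; the constant term makes it vanish at
   [x]. *)
pose s := (- \sum_i l i * x (row i B), 0) :: [seq (l i, row i B) | i : 'I_d].
have sE y : leval s y = \sum_i l i * y (row i B) - (\sum_i l i * x (row i B)) * y 0.
  by rewrite /leval big_cons big_map big_enum /= mulNr addrC.
pose phi (e : bool) (Q : X) := f Q - \sum_i (if e then c0 else c1) 0 i * t i Q.
have sphi e : square_local V x (phi e) by case: e; [exact: sq | exact: sq1].
have := square_local_comb [:: true; false] (fun e : bool => if e then 1 else -1) sphi.
move=> sq2; apply/rowP => i; apply/eqP; rewrite eq_sym -subr_eq0 -/(l i); apply/eqP.
have := derivation_square_local (partial_derivation i) xP sq2 (s := s).
rewrite [leval s (partial i)]sE (bigD1 i) //= partial_row eqxx mulr1.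
rewrite big1 ?addr0 => [|j /negbTE ji]; last by rewrite partial_row ji mulr0.
rewrite [partial i 0]/partial coo0 !mul0r mulr0 subr0; apply.
- move=> e; rewrite inE => /orP[/eqP->|/mapP[j _ ->]]; first exact: dual_semigroup0.
  exact: row_semigroup.
- by rewrite sE (chart0 Vx) mulr1 subrr.
move=> y Q yQ; rewrite sE (chart0 (coord_atlas yQ).2) mulr1.
rewrite big_cons big_seq1 mul1r mulN1r opprB addrC addrA subrK -!sumrB.
by apply: eq_bigr => j _; rewrite (tE _ _ _ yQ) /l /cc; ring.
Qed.

Let X0 i : k := x (row i B).

Let L j (Q : X) : Prop := exists w,
  (forall i : 'I_d, (j <= i)%N -> w i = X0 i) /\ chart_coord V (affine_point w) Q.

(* The closure of a coordinate subspace through x. *)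
Let Z j : set X := [set Q | forall C : set X, is_closed C -> L j `<=` C -> C Q].

Let LZ j : L j `<=` Z j.
Proof. by move=> Q LQ C _; apply. Qed.

Let closed_Z j : is_closed (Z j).
Proof.
move=> g Sg; split; first exact: preimage_sub.
move=> y [Q nZQ yQ].
have [C [Ccl LC nCQ]] : exists C : set X, [/\ is_closed C, L j `<=` C & ~ C Q].
  apply: contrapT => H; apply: nZQ => C Ccl LC; apply: contrapT => nCQ.
  by apply: H; exists C.
have [_ /(_ y)[|f [pf fy fC]]] := Ccl g Sg; first by exists Q.
exists f; split=> // y' gy' fy'; have [Q' nCQ' y'Q'] := fC y' gy' fy'.
by exists Q' => // ZQ'; apply: nCQ'; exact: ZQ'.
Qed.

(** If neither closed set contains [L j], two functions nonvanishing at suitable points of [L j]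
    define open sets off [Z1] and off [Z2]. On the line through these points, which stays in [L j],
    both restrict to nonzero polynomials, so some point escapes both closed sets. *)
Let irreducible_Z j : irreducible_closed (Z j).
Proof.
split; first exact: closed_Z.
  by exists P; apply: LZ; exists X0; split=> //; rewrite -chart_affine.
move=> Z1 Z2 cl1 cl2 ZZ.
have [LZ1|/existsNP[Q1 /not_implyP[[w1 [w1x w1Q]] Q1Z]]] := pselect (forall Q, L j Q -> Z1 Q).
  by left=> Q; apply.
have [LZ2|/existsNP[Q2 /not_implyP[[w2 [w2x w2Q]] Q2Z]]] := pselect (forall Q, L j Q -> Z2 Q).
  by right=> Q; apply.
have [F1 [VF1 F1w FZ1]] := open_local fan cl1 Q1Z w1Q.
have [F2 [VF2 F2w FZ2]] := open_local fan cl2 Q2Z w2Q.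
have [p1 p1E] := regular_line w1 w2 VF1; have [p2 p2E] := regular_line w1 w2 VF2.
have p1n0 : p1 != 0.
  apply: contraNneq F1w => p10; have := p1E 0; rewrite p10 horner0 => <-.
  by apply/eqP; congr (F1 (affine_point _)); apply/funext => i; rewrite mul0r addr0.
have p2n0 : p2 != 0.
  apply: contraNneq F2w => p20; have := p2E 1; rewrite p20 horner0 => <-.
  by apply/eqP; congr (F2 (affine_point _)); apply/funext => i; rewrite mul1r addrC subrK.
have [s] := nonroot (mulf_neq0 p1n0 p2n0).
rewrite hornerM mulf_eq0 negb_or -p1E -p2E => /andP[F1s F2s].
set w := (fun i => _) in F1s F2s.
have [Q wQ] := coord_exists SV (affine_chart w).
have : (Z1 `|` Z2) Q.
  apply: ZZ; apply: LZ; exists w; split=> // i ji.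
  by rewrite /w w1x // w2x // subrr mulr0 addr0.
case=> [Q1'|Q2']; exfalso.
  by apply: (FZ1 Q) => //; exists (affine_point w).
by apply: (FZ2 Q) => //; exists (affine_point w).
Qed.

Lemma free_chain : chain_at P d.
Proof.
exists Z; split; [|by move=> i _; exact: irreducible_Z|].
  by apply: LZ; exists X0; split=> //; rewrite -chart_affine.
move=> j jd; split.
  move=> Q ZQ C Ccl LC; apply: ZQ => // Q' [w [wx wQ']]; apply: LC.
  by exists w; split=> // i ji; apply: wx; exact: ltnW.
pose j' := Ordinal jd.
(* Moving the coordinate [j] away from that of [x] leaves the closed locus [cc j' = 0], which
   contains [L j] and hence [Z j]. *)
pose w i := if i == j' then X0 i + 1 else X0 i.
have [Q wQ] := coord_exists SV (affine_chart w).
move=> /(_ Q) ZQ; have /ZQ : Z j.+1 Q.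
  apply: LZ; exists w; split=> // i ji; rewrite /w; case: eqP => // ij.
  by rewrite ij ltnn in ji.
move=> /(_ (~` basic_open (cc j'))); apply.
- by rewrite /is_closed setCK; apply: basic_open_open.
- move=> Q' [w' [w'x w'Q']] [y yQ'].
  rewrite -(coord_inj fan w'Q' yQ') /cc affine_point_row w'x //.
  by rewrite subrr eqxx.
exists (affine_point w) => //.
by rewrite /cc affine_point_row /w eqxx addrC addKr oner_neq0.
Qed.

Lemma free_local_dim : local_dim P d.
Proof. by split; [exact: free_chain | move=> m; exact: chain_length]. Qed.

End Point.
End FreeChart.

(** * The combinatorial criterion *)

Section Nonsingular.
Context {R : realType} {d : nat} {k : closedFieldType}.
Variable Sigma Max : set (set 'rV[R]_d).
Hypothesis fan : polyhedral_fan Sigma.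
Hypothesis MaxS : Max `<=` Sigma.
Hypothesis MaxF : Max `<=` pointed_full_dual.
Hypothesis SMax : forall g, Sigma g -> exists2 V, Max V & g `<=` V.
Local Notation X := (toric_variety k Sigma).

(** Each unit vector is a difference of two elements of the semigroup, so the irreducibles generate
    the lattice and number at least [d]. With the bound there are exactly [d], and their square
    matrix is invertible over the integers. *)
Lemma few_irreducibles_free (V : set 'rV[R]_d) : pointed_full_dual V ->
  (forall s : seq 'rV[int]_d, uniq s ->
    (forall a, a \in s -> irreducible_in (dual_cone V) a) -> (size s <= d)%N) ->
  free_semigroup V.
Proof.
move=> [E [VE Epointed [h dn0 Vh]]] few.
have [s0 irrs0] := @irreducible_finite R d E.
pose s := undup [seq a <- s0 | `[< irreducible_in (dual_cone V) a >]].
have sE a : a \in s <-> irreducible_in (dual_cone V) a.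
  rewrite mem_undup mem_filter; split; first by case/andP => /asboolP.
  move=> airr; apply/andP; split; first exact/asboolP.
  by apply: irrs0; rewrite -VE.
have sd : (size s <= d)%N by apply: few; [exact: undup_uniq | move=> a /sE].
have span a : dual_semigroup V a -> exists y : 'rV[int]_(size s),
    (forall i, 0 <= y 0 i) /\ a = y *m \matrix_i nth 0 s i.
  rewrite /dual_semigroup VE => Va.
  have [t tirr ->] := irreducible_gen Epointed Va.
  elim: t tirr => [|b t IH] tirr.
    by exists 0; rewrite big_nil mul0mx; split=> // i; rewrite mxE.
  have [y [y0 yE]] := IH (fun c ct => tirr c (mem_behead (s := b :: t) ct)).
  have bs : (index b s < size s)%N.
    by rewrite index_mem; apply/sE; rewrite VE; apply: tirr; exact: mem_head.
  exists (delta_mx 0 (Ordinal bs) + y); split.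
    by move=> i; rewrite !mxE addr_ge0 //; case: (_ && _).
  by rewrite big_cons mulmxDl -rowE rowK /= nth_index -?index_mem // -yE.
have [N Nh] := simp_unit_shift (R := R) dn0.
have hV : simp_cone h `<=` dual_cone V.
  by rewrite VE; apply: cone_hullS => _ [_ /mapP[i _ ->] <-]; rewrite -/(icone _) -VE; exact: Vh.
have /choice[Y YE] : forall j, exists y : 'rV[int]_(size s),
    delta_mx 0 j = y *m \matrix_i nth 0 s i.
  move=> j; have [y1 [_ y1E]] := span _ (hV _ (Nh j)).
  have [y2 [_ y2E]] : exists y : 'rV[int]_(size s),
      (forall i, 0 <= y 0 i) /\ (\sum_i h i) *+ N = y *m \matrix_i nth 0 s i.
    apply: span; apply: dual_semigroupMn.
    by elim/big_ind: _ => //; [exact: dual_semigroup0 | exact: dual_semigroupD].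
  by exists (y1 - y2); rewrite mulmxBl -y1E -y2E addrK.
have YM : (\matrix_j Y j) *m (\matrix_i nth 0 s i) = 1%:M :> 'M[int]_d.
  by apply/row_matrixP => j; rewrite row_mul rowK -YE row1.
have sz : size s = d by apply/eqP; rewrite eqn_leq sd (mulmx1_min YM).
move: (\matrix_j Y j) YM span (@mem_nth _ 0 s).
move: (nth 0 s) => b; rewrite sz => Y' Y'M span bs.
exists (\matrix_(i < d) b i), Y'; split; first exact: mulmx1C.
move=> a; split.
  by move=> /span[y [y0 ->]] i; rewrite -mulmxA (mulmx1C Y'M) mulmx1.
move=> a0; rewrite -[a]mulmx1 -Y'M mulmxA mulmx_sum_row.
elim/big_ind: _ => [||i _]; [exact: dual_semigroup0 | exact: dual_semigroupD |].
rewrite rowK -[_ 0 i](gez0_abs (a0 i)) -natz scaler_nat.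
apply: dual_semigroupMn.
by have /sE[] : b i \in s by exact: bs.
Qed.

Lemma nonsingular_free : nonsingular X <-> forall V, Max V -> free_semigroup V.
Proof.
split=> [Xns V MV|free P].
  have VF := MaxF MV; apply: few_irreducibles_free (VF) _ => s us sirr.
  have [P PV] : exists P : X, forall n (s : seq 'rV[int]_d), cotangent_dim P n -> uniq s ->
    (forall a, a \in s -> irreducible_in (dual_cone V) a) -> (size s <= n)%N.
    apply: (cotangent_dim_irreducibles fan (MaxS MV)) => a b Va Vb ab0.
    have [E [VE Epointed _]] := VF; apply: (@toR_inj R); rewrite toR0.
    have bE : b = - a by apply/eqP; rewrite -addr_eq0 addrC ab0.
    by apply: Epointed; rewrite -VE // -toRN -bE.
  have [n [chn _] cotn] := Xns P.
  (* The local and cotangent dimensions share the value [n]: it bounds the number of irreducibles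
     and is itself at most [d]. *)
  exact: leq_trans (PV n s cotn us sirr) (chain_length fan chn).
have [g [x xP]] := point_coord P; have [Sg gx] := coord_atlas xP.
have [V MV gV] := SMax Sg; have SV := MaxS MV.
have [B [B' [BB' VE]]] := free V MV.
have VP := coord_widen fan gV SV xP.
exists d; first exact: (free_local_dim BB' VE fan SV VP).
exact: (free_cotangent_dim BB' VE fan VP).
Qed.

End Nonsingular.

Theorem corollary2p19 (R : realType) (d : nat) (sigma : set 'rV[R]_d)
    (sigma_rat : rational_polyhedral_cone sigma)
    (sigma_sconv : strongly_convex sigma)
    (sigma_full : full_dimensional sigma)
    (dual_stable : G_stable (dual_cone sigma))
    (K : nat -> closedFieldType)
    (K_char : forall p, p = 0%N \/ prime p -> has_characteristic (K p) p) :
  let X p := toric_variety (K p) (nash_fan p sigma) in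
  (forall P : (forall k : closedFieldType, function_space k -> Prop),
     (exists Q : set (set 'rV[R]_d) -> Prop,
        forall p, p = 0%N \/ prime p ->
          (P (K p) (X p) <-> Q (nash_fan p sigma))) ->
     forall p, prime p -> (P (K 0%N) (X 0%N) <-> P (K p) (X p)))
  /\ (forall p, prime p -> (nonsingular (X 0%N) <-> nonsingular (X p))).
Proof.
move=> X.
have fanE p : prime p -> nash_fan p sigma = nash_fan 0 sigma.
  by move=> pp; rewrite /nash_fan nash_polyhedron_charfree.
split=> [P [Q PQ] p pp|p pp].
  by rewrite PQ; [rewrite PQ; [rewrite fanE | right] | left].
(* The criterion depends on [Max] and not on the field, so it serves as a common middle term over
   [K 0] and [K p]. *)
have [fan [Max [MaxS MaxF SMax]]] := nash_fan_structure sigma_rat sigma_full.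
rewrite /X fanE //.
by split=> /(nonsingular_free fan MaxS MaxF SMax) H;
  apply/(nonsingular_free fan MaxS MaxF SMax).
Qed.
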